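(* Assume that the small-ball assumption holds with constants $\kappa,\delta>0$, i.e. for every $h\in\mathbb H$, $\mathbb P\big(|\langle X,h\rangle|\ge \kappa\|\langle h,X\rangle\|_{L_2(\mu)}\big)\ge\delta$. Set $\gamma=\kappa\delta/32$ and let $\lambda>0$. Then there is an event of probability at least $1-2\exp(-\delta^2 n/16)$ on which $$\|\langle\hat h_\lambda-h^*,X\rangle\|_{L_2(\mu)}\le\max\Big\{\frac{2\sqrt8}{\sqrt\delta\,\kappa}\Big(\frac{\|\xi\|_2}{\sqrt n}+\sqrt{\lambda\|h^*\|}\Big),\ r^*(\gamma)\big(2\|h^*\|+\|\hat\nu\|\big)\Big\}.$$ Moreover, if there exist $\zeta,\bar\zeta>0$ such that $\Delta(\gamma,h^* )\ge\zeta$ and $\bar\Delta(\gamma,h^* )\le\bar\zeta$, then on the same event $$\|\langle\hat h_\lambda-h^*,X\rangle\|_{L_2(\mu)}\le\max\Big\{\frac{4\sqrt8}{\sqrt\delta\,\kappa}\frac{\|\xi\|_2}{\sqrt n}+\frac{32}{\delta\kappa^2}\frac{\lambda\bar\zeta}{r^*(\gamma)},\ \frac{r^*(\gamma)\|\hat\nu\|}{\zeta}\Big\},$$ where $\lambda\bar\zeta/r^*(\gamma)$ is read as $+\infty$ if $r^*(\gamma)=0$.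
   Context: $\mathbb H$ is a (real) Hilbert space with inner product $\langle\cdot,\cdot\rangle$, and $\|\cdot\|$ is a norm defined on $\mathbb H$. Observations $(Y_i,X_i)_{i=1}^n$ satisfy $Y_i=\langle X_i,h^*\rangle+\xi_i$, where $h^*\in\mathbb H$ is the unknown parameter, $X_1,\dots,X_n$ are i.i.d. random elements of $\mathbb H$ with distribution $\mu$, and $\xi=(\xi_1,\dots,\xi_n)\in\mathbb R^n$ is an arbitrary error vector (deterministic, random, or depending adversarially on the $X_i$ and $h^*$). $\|\xi\|_2$ is the Euclidean norm. $X$ denotes an independent copy of $X_1$, and for $h\in\mathbb H$, $\|\langle X,h\rangle\|_{L_2(\mu)}^2:=\int\langle h,x\rangle^2\,d\mu(x)$ (when $h$ is data-dependent, the integral is over $x$ only). Regularized empirical risk minimizer: $\hat h_\lambda$ is a minimizer over $h\in\mathbb H$ of $\frac1n\sum_{i=1}^n(Y_i-\langle X_i,h\rangle)^2+2\lambda\|h\|$. Interpolated noise: $\hat\nu$ is a minimizer of $\|h\|$ over $h\in\mathbb H$ subject to $\langle X_i,h\rangle=\xi_i$ for all $i$. Both minimizers are assumed to exist. Local Rademacher complexity: with $B=\{h\in\mathbb H:\|h\|\le1\}$ and $\varepsilon_1,\dots,\varepsilon_n$ i.i.d. Rademacher variables independent of the $X_i$, $$r^*(\gamma)=\inf\Big\{r>0:\ \mathbb E\sup_{h\in B:\ \|\langle X,h\rangle\|_{L_2(\mu)}\le r}\ \sum_{i=1}^n\varepsilon_i\langle X_i,h\rangle\le\gamma n r\Big\}.$$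 Subdifferential quantities: let $\|g\|^*=\sup_{\|x\|\le1}\langle g,x\rangle$ be the dual norm, $S^*=\{g\in\mathbb H:\|g\|^*=1\}$, $\partial(\|\cdot\|)_{h^*}=\{g\in S^*:\langle g,h^*\rangle=\|h^*\|\}$, $H_{r,\gamma}=\{h\in\mathbb H:\|\langle X,h\rangle\|_{L_2(\mu)}\le r^*(\gamma),\ \|h\|=1\}$, $\bar H_{r,\gamma}=\{h\in\mathbb H:\|\langle X,h\rangle\|_{L_2(\mu)}=r^*(\gamma),\ \|h\|\le1\}$. Then $$\Delta(\gamma,h^* )=\inf_{h\in H_{r,\gamma}}\sup_{g\in\partial(\|\cdot\|)_{h^*}}\langle g,h\rangle,\qquad \bar\Delta(\gamma,h^* )=\sup_{h\in\bar H_{r,\gamma}}\inf_{g\in\partial(\|\cdot\|)_{h^*}}\langle g,h\rangle.$$ *)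

(* Defs.v *)
From HB Require Import structures.
From mathcomp Require Import all_boot all_order all_algebra.
From mathcomp Require Import all_classical all_reals all_analysis.

Set Implicit Arguments.
Unset Strict Implicit.
Unset Printing Implicit Defensive.

Import Order.TTheory GRing.Theory Num.Theory.
Import numFieldNormedType.Exports.

Local Open Scope classical_set_scope.
Local Open Scope ring_scope.

(* A real Hilbert space is a [completeNormedModType R] together with a dot
   product satisfying [hilbertian]; [`|h|] is the Hilbert norm.  The norm
   written ||.|| in the mathematics is a second, unrelated norm [N : H -> R]. *)
Definition hilbertian (R : realType) (H : normedModType R)
    (dot : {dot H for idfun}) : Prop :=
  forall h : H, dot h h = `|h| ^+ 2.

Record is_norm (R : realType) (H : lmodType R) (N : H -> R) : Prop := IsNorm {
  is_normD : forall x y, N (x + y) <= N x + N y ;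
  is_normZ : forall (a : R) x, N (a *: x) = `|a| * N x ;
  is_norm0 : forall x, N x = 0 -> x = 0 }.

Notation borel H := (g_sigma_algebraType (@open H)).

(* The law of a random element of H is carried by a separable closed subset.
   This is automatic when H is separable; otherwise it is what distinguishes a
   (Bochner) random element from a merely Borel measurable map. *)
Definition separably_supported (R : realType) (H : normedModType R)
    (mu : probability (borel H) R) : Prop :=
  exists2 D : set H, countable D & mu (closure D) = 1%E.

Definition sigma_of d d' (T : measurableType d) (T' : measurableType d')
    (f : T -> T') : set_system T :=
  preimage_set_system setT f measurable.

Definition mutually_independent d (T : measurableType d) (R : realType)
    (P : probability T R) (I : finType) (F : I -> set_system T) : Prop :=
  forall (J : {set I}) (A : I -> set T),
    (forall i, i \in J -> F i (A i)) ->
    P (\bigcap_(i in [set` J]) A i) = (\prod_(i in J) P (A i))%E.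

Definition is_rademacher d (T : measurableType d) (R : realType)
    (P : probability T R) (e : T -> R) : Prop :=
  P (e @^-1` [set 1]) = (2^-1)%:E /\ P (e @^-1` [set -1]) = (2^-1)%:E.

Definition is_minimizer (R : realType) (T : Type) (C : set T) (F : T -> R)
    (x : T) : Prop :=
  C x /\ forall y, C y -> F x <= F y.

Definition euclidean_norm (R : realType) (n : nat) (x : 'I_n -> R) : R :=
  Num.sqrt (\sum_i x i ^+ 2).

Section RegularizedRegression.
Context {R : realType} {H : completeNormedModType R}.
Variables (dot : {dot H for idfun}) (N : H -> R) (mu : probability (borel H) R).

(* An extended real: it is +oo when <X, h> is not square integrable. *)
Definition L2norm (h : H) : \bar R :=
  ('N[mu]_(2%:E)[(fun x : borel H => (dot x h)%:E)])%E.

Definition small_ball (kappa delta : R) : Prop :=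
  forall h : H,
    (delta%:E <=
     mu [set x : borel H | (kappa%:E * L2norm h <= `|dot x h|%:E)%E])%E.

Definition rerm_objective (n : nat) (lambda : R) (x : 'I_n -> H)
    (y : 'I_n -> R) (h : H) : R :=
  n%:R^-1 * \sum_i (y i - dot (x i) h) ^+ 2 + 2 * lambda * N h.

Definition interpolants (n : nat) (x : 'I_n -> H) (y : 'I_n -> R) : set H :=
  [set h | forall i, dot (x i) h = y i].

Definition localized_ball (r : R) : set H :=
  [set h | N h <= 1 /\ (L2norm h <= r%:E)%E].

Definition rademacher_complexity d (Omega : measurableType d)
    (P : probability Omega R) (n : nat) (X : 'I_n -> {RV P >-> borel H})
    (eps : 'I_n -> {RV P >-> R}) (r : R) : \bar R :=
  (\int[P]_w ereal_sup
     [set (\sum_i eps i w * dot (X i w) h)%R%:E | h in localized_ball r])%E.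

Definition rstar d (Omega : measurableType d)
    (P : probability Omega R) (n : nat) (X : 'I_n -> {RV P >-> borel H})
    (eps : 'I_n -> {RV P >-> R}) (gamma : R) : \bar R :=
  ereal_inf [set r%:E | r in
    [set r : R | 0 < r /\
       (rademacher_complexity X eps r <= (gamma * n%:R * r)%:E)%E]].

Definition dual_norm (g : H) : \bar R :=
  ereal_sup [set (dot g x)%:E | x in [set x | N x <= 1]].

Definition subdiff (h : H) : set H :=
  [set g | dual_norm g = 1%E /\ dot g h = N h].

(* In the next two definitions [r] stands for the value of [rstar]. *)
Definition Delta (r : \bar R) (h0 : H) : \bar R :=
  ereal_inf
    [set ereal_sup [set (dot g h)%:E | g in subdiff h0]
    | h in [set h | (L2norm h <= r)%E /\ N h = 1]].

Definition Deltabar (r : \bar R) (h0 : H) : \bar R :=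
  ereal_sup
    [set ereal_inf [set (dot g h)%:E | g in subdiff h0]
    | h in [set h | L2norm h = r /\ N h <= 1]].

End RegularizedRegression.

(* Main.v *)
Require Import Defs.
From HB Require Import structures.
From mathcomp Require Import all_boot all_order all_algebra.
From mathcomp Require Import all_classical all_reals all_analysis.
From mathcomp Require Import measurable_realfun ring lra.

Set Implicit Arguments.
Unset Strict Implicit.
Unset Printing Implicit Defensive.

Import Order.TTheory GRing.Theory Num.Theory.
Import numFieldNormedType.Exports.

Local Open Scope classical_set_scope.
Local Open Scope ring_scope.

(* Small-ball method.  Write l for the L2(mu)-norm and rho for r*(gamma).  On an
   event of the required probability, the empirical second moment of <X, h> is at
   least (delta kappa^2 / 8) l(h)^2 for every h with l(h) >= rho ||h||: by
   homogeneity only l(h) = r, ||h|| <= 1 matters, where a Lipschitz ramp of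
   |<X, h>| lies between the indicator of the small-ball event and
   4 <X, h>^2 / (kappa r)^2, and where the supremum of the centred ramp sums is
   controlled by bounded differences, symmetrization and contraction.  Comparing
   the objective at hhat with its values at hstar and at hstar + nuhat (which
   interpolates the data) then bounds the error when l >= rho ||.|| at
   hhat - hstar, and bounds ||hhat - hstar|| otherwise.

   Suprema are handled over finite families only.  For such a family the functions
   <., h> are replaced by simple functions, so that expectations over the
   independent sample become finite weighted sums and no product measure is
   needed; a countable weakly dense family, obtained from the separable support
   of mu, gives back the full class. *)

Lemma le_of_eq d (T : porderType d) (x y : T) : x = y -> (x <= y)%O.
Proof. by move=> ->. Qed.

(** * Weighted sums over finite products and maxima of finite families *)

Section FiniteProducts.
Context {R : realType}.
Implicit Types (T J : finType).

(** The expectation of [G] over [n] independent draws with weight [p]. It is an iterated sum over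
    sequences so that inductions can peel off the first draw and keep it fixed. *)
Fixpoint Eprod T (p : T -> R) (n : nat) (G : seq T -> R) : R :=
  if n is m.+1 then \sum_t p t * Eprod p m (fun s => G (t :: s)) else G [::].

Definition is_weight T (p : T -> R) : Prop :=
  (forall t, 0 <= p t) /\ \sum_t p t = 1.

Lemma Eprod_le T (p : T -> R) n G1 G2 : (forall t, 0 <= p t) ->
  (forall s, size s = n -> G1 s <= G2 s) -> Eprod p n G1 <= Eprod p n G2.
Proof.
move=> p0; elim: n G1 G2 => [|n IH] G1 G2 G12 /=; first exact: G12.
apply: ler_sum => t _; apply: ler_wpM2l => //; apply: IH => s sn.
by apply: G12; rewrite /= sn.
Qed.

Lemma EprodZ T (p : T -> R) n a G :
  Eprod p n (fun s => a * G s) = a * Eprod p n G.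
Proof.
elim: n G => [|n IH] G //=; rewrite mulr_sumr; apply: eq_bigr => t _.
by rewrite IH mulrCA.
Qed.

Lemma EprodD T (p : T -> R) n G1 G2 :
  Eprod p n (fun s => G1 s + G2 s) = Eprod p n G1 + Eprod p n G2.
Proof.
elim: n G1 G2 => [|n IH] G1 G2 //=; rewrite -big_split; apply: eq_bigr => t _.
by rewrite IH mulrDr.
Qed.

Lemma eq_Eprod T (p : T -> R) n G1 G2 : G1 =1 G2 -> Eprod p n G1 = Eprod p n G2.
Proof. by move=> /funext ->. Qed.

Lemma Eprod_sum T (p : T -> R) n (I : finType) (G : I -> seq T -> R) :
  Eprod p n (fun s => \sum_i G i s) = \sum_i Eprod p n (G i).
Proof.
elim: n G => [|n IH] G //=; rewrite exchange_big; apply: eq_bigr => t _ /=.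
by rewrite IH mulr_sumr.
Qed.

Lemma Eprod_cst T (p : T -> R) n c : is_weight p -> Eprod p n (fun=> c) = c.
Proof.
by case=> _ p1; elim: n => [|n IH] //=; rewrite IH -mulr_suml p1 mul1r.
Qed.

Lemma Eprod_tuple T (p : T -> R) n (G : seq T -> R) :
  Eprod p n G = \sum_(t : n.-tuple T) (\prod_i p (tnth t i)) * G t.
Proof.
elim: n G => [|n IH] G /=.
  rewrite (big_pred1 [tuple]) => [|t]; last exact/esym/eqP/tuple0.
  by rewrite big_ord0 mul1r.
rewrite (reindex (fun u : T * n.-tuple T => [tuple of u.1 :: u.2])) /=; last first.
  exists (fun t : n.+1.-tuple T => (thead t, [tuple of behead t])) => [[x t] _|t _].
    by congr pair; apply: val_inj.
  by rewrite -tuple_eta.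
rewrite -(pair_big xpredT xpredT (fun x (t : n.-tuple T) =>
   (\prod_i p (tnth [tuple of x :: t] i)) * G (x :: t))) /=.
apply: eq_bigr => x _; rewrite IH mulr_sumr; apply: eq_bigr => t _.
rewrite big_ord_recl mulrA; congr (_ * _ * _).
by apply: eq_bigr => i _; rewrite tnthS.
Qed.

Section MaxOver.
Variables (J : finType) (j0 : J).

(** The real line has no least element, so the value at [j0] starts the iterated maximum. *)
Definition maxover (c : J -> R) : R := \big[Num.max/c j0]_j c j.

Lemma maxover_ge c j : c j <= maxover c.
Proof. exact: le_bigmax. Qed.

Lemma maxover_le c a : (forall j, c j <= a) -> maxover c <= a.
Proof. by move=> ca; apply: bigmax_le. Qed.

Lemma maxoverD_le c c' a : (forall j k, c j + c' k <= a) ->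
  maxover c + maxover c' <= a.
Proof.
move=> cc'; rewrite -lerBrDr; apply: maxover_le => j; rewrite lerBrDr.
by rewrite addrC -lerBrDr; apply: maxover_le => k; rewrite lerBrDr addrC.
Qed.

Lemma maxover_sum_le T (p : T -> R) (c : T -> J -> R) : (forall t, 0 <= p t) ->
  maxover (fun j => \sum_t p t * c t j) <= \sum_t p t * maxover (c t).
Proof.
move=> p0; apply: maxover_le => j; apply: ler_sum => t _.
by apply: ler_wpM2l => //; apply: maxover_ge.
Qed.

Lemma eq_maxover c c' : c =1 c' -> maxover c = maxover c'.
Proof. by move=> /funext ->. Qed.

End MaxOver.

Definition sgb (b : bool) : R := if b then 1 else -1.

Lemma sum_signed T (F : T * bool -> R) :
  \sum_u F u = \sum_t (F (t, true) + F (t, false)).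
Proof.
rewrite (eq_bigr (fun u => F (u.1, u.2))); last by case.
rewrite -(pair_big xpredT xpredT (fun t b => F (t, b))) /=.
by apply: eq_bigr => t _; rewrite big_bool.
Qed.

(** * Symmetrization and contraction for finite families *)

Section Symmetrization.
Variables (T J : finType) (j0 : J) (p : T -> R) (f v : J -> T -> R) (L : R).
Hypothesis pw : is_weight p.
Hypothesis fL : forall j k t, `|f j t - f k t| <= L * `|v j t - v k t|.

(** The law of a draw from [p] paired with an independent fair sign. *)
Definition signed_weight (u : T * bool) : R := p u.1 / 2.

Lemma signed_weightP : is_weight signed_weight.
Proof.
case: pw => p0 p1; split=> [u|]; first by rewrite divr_ge0.
rewrite sum_signed /signed_weight /= -[RHS]p1; apply: eq_bigr => t _; lra.
Qed.

Let mean j := \sum_t p t * f j t.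

(* Symmetrization and contraction performed on one coordinate at a time, the
   other coordinates entering only through the offsets [c]: thus no ghost
   sample is exchanged and no joint sign flip is needed. *)
Lemma symmetrize1 (c : J -> R) :
  \sum_t p t * maxover j0 (fun j => c j + (mean j - f j t)) <=
  \sum_u signed_weight u *
    maxover j0 (fun j => c j + 2 * L * sgb u.2 * v j u.1).
Proof.
case: pw => p0 p1.
pose A t := maxover j0 (fun j => c j + 2 * f j t).
pose B t := maxover j0 (fun j => c j - 2 * f j t).
(* The function inside is the average of [c + 2 f(t')] and [c - 2 f(t)], which decouples [t] from
   [t']. *)
have pair t t' : maxover j0 (fun j => c j + (f j t' - f j t)) <= (A t' + B t) / 2.
  apply: maxover_le => j.
  have := maxover_ge j0 (fun j => c j + 2 * f j t') j.
  have := maxover_ge j0 (fun j => c j - 2 * f j t) j.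
  rewrite -/(A t') -/(B t) /=; lra.
have ghost t : maxover j0 (fun j => c j + (mean j - f j t)) <=
    \sum_t' p t' * ((A t' + B t) / 2).
  apply: (@le_trans _ _ (\sum_t' p t' * maxover j0 (fun j => c j + (f j t' - f j t)))).
    rewrite (@eq_maxover _ _ _ (fun j => \sum_t' p t' * (c j + (f j t' - f j t)))).
      exact: maxover_sum_le.
    move=> j; under eq_bigr do rewrite mulrDr mulrBr.
    by rewrite big_split sumrB -!mulr_suml p1 !mul1r.
  by apply: ler_sum => t' _; apply: ler_wpM2l.
apply: (@le_trans _ _ (\sum_t p t / 2 * (A t + B t))).
  apply: le_trans (ler_sum _ (fun t _ => ler_wpM2l (p0 t) (ghost t))) _.
  under eq_bigr => t _ do under eq_bigr => t' _ do rewrite mulrDl mulrDr.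
  under eq_bigr => t _ do rewrite big_split -mulr_suml p1 mul1r mulrDr.
  rewrite big_split -mulr_suml p1 mul1r -big_split /=.
  by apply/le_of_eq/eq_bigr => t _; lra.
rewrite sum_signed /signed_weight /=; apply: ler_sum => t _.
rewrite -mulrDr; apply: ler_wpM2l; first by rewrite divr_ge0.
apply: maxoverD_le => j k.
(* Contraction: the sign of [v j t - v k t] decides which of [j], [k] is tested with the sign 1 and
   which with -1; the Lipschitz bound does the rest. *)
have P j' := maxover_ge j0 (fun j => c j + 2 * L * 1 * v j t) j'.
have M j' := maxover_ge j0 (fun j => c j + 2 * L * -1 * v j t) j'.
have := P j; have := P k; have := M j; have := M k.
have := ler_norm (f j t - f k t); have := fL j k t.
case: (lerP 0 (v j t - v k t)) => [/ger0_norm ->|/ltr0_norm ->] /=; nra.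
Qed.

(** Induction on the sample: with the head fixed, its centred term joins the offset and the
    induction hypothesis treats the tail; with the signed tail fixed, [symmetrize1] then treats the
    head. *)
Lemma symmetrize n (c : J -> R) :
  Eprod p n (fun s => maxover j0 (fun j => c j + \sum_(t <- s) (mean j - f j t)))
  <= Eprod signed_weight n (fun s =>
       maxover j0 (fun j => c j + 2 * L * \sum_(u <- s) sgb u.2 * v j u.1)).
Proof.
case: (pw) => p0 p1; case: signed_weightP => q0 q1.
elim: n c => [|n IH] c /=.
  by apply/le_of_eq/eq_maxover => j; rewrite !big_nil mulr0.
apply: (@le_trans _ _ (\sum_t p t * Eprod signed_weight n (fun s =>
    maxover j0 (fun j => (c j + 2 * L * \sum_(u <- s) sgb u.2 * v j u.1) +
       (mean j - f j t))))).
  apply: ler_sum => t _; apply: ler_wpM2l => //.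
  have := IH (fun j => c j + (mean j - f j t)).
  under eq_Eprod => s.
    under eq_maxover => j.
      rewrite -addrA -(big_cons _ _ t s xpredT (fun t => mean j - f j t)).
      over.
    over.
  by under [leRHS]eq_Eprod => s do under eq_maxover => j do rewrite addrAC.
under [leLHS]eq_bigr do rewrite -EprodZ.
under [leRHS]eq_bigr do rewrite -EprodZ.
rewrite -!Eprod_sum.
apply: Eprod_le => // s _.
apply: le_trans (symmetrize1 _) _.
apply/le_of_eq/eq_bigr => u _.
congr (_ * _); apply: eq_maxover => j.
by rewrite big_cons mulrDr !mulrA [X in _ = _ + X]addrC addrA.
Qed.

End Symmetrization.

(** * Exponential moments and bounded differences *)

Lemma fact_double_ge k : (2 ^ k * k`! <= (k.*2)`!)%N.
Proof.
elim: k => // k IH; rewrite doubleS !factS expnS mulnACA [leqRHS]mulnA.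
by apply: leq_mul => //; rewrite mul2n doubleS leq_pmulr.
Qed.

(** Comparison of power series: the odd terms cancel, and the even ones are compared through
    [(2k)! >= 2^k k!]. *)
Lemma expRD_expRN_le (x : R) : expR x + expR (- x) <= 2 * expR (x ^+ 2 / 2).
Proof.
pose c i := exp_coeff x i + exp_coeff (- x) i.
have codd k : c k.*2.+1 = 0.
  by rewrite /c /exp_coeff /= !exprS -mul2n !(exprM _ 2) sqrrN !mulNr subrr.
have ceven k : c k.*2 = 2 * (x ^+ k.*2 / (k.*2)`!%:R).
  rewrite /c /exp_coeff /= -mul2n !(exprM _ 2) sqrrN; lra.
have ev0 k : 0 <= x ^+ k.*2 by rewrite -mul2n exprM exprn_ge0// sqr_ge0.
have c0 i : 0 <= c i.
  rewrite -(odd_double_half i); case: (odd i); rewrite ?add1n ?codd ?add0n//.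
  by rewrite ceven mulr_ge0// divr_ge0.
have cle n : \sum_(0 <= i < n.*2) c i <= 2 * series (exp_coeff (x ^+ 2 / 2)) n.
  rewrite /series /=; elim: n => [|n IH]; first by rewrite !big_geq// mulr0.
  rewrite doubleS !big_nat_recr//= codd addr0 mulrDr; apply: lerD => //.
  rewrite ceven ler_pM2l// /exp_coeff /= expr_div_n -exprM mul2n -mulrA.
  apply: ler_wpM2l => //; rewrite -invfM.
  rewrite lef_pV2 ?posrE ?mulr_gt0 ?exprn_gt0 ?ltr0n ?fact_gt0//.
  by rewrite -natrX -natrM ler_nat fact_double_ge.
have sle n : series (exp_coeff (x ^+ 2 / 2)) n <= expR (x ^+ 2 / 2).
  apply: nondecreasing_cvgn_le; last exact: is_cvg_series_exp_coeff.
  by apply: nondecreasing_series => i _ _; rewrite exp_coeff_ge0// divr_ge0// sqr_ge0.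
have cvgc : (series (exp_coeff x) n + series (exp_coeff (- x)) n) @[n --> \oo]
    --> expR x + expR (- x).
  by apply: cvgD; exact: is_cvg_series_exp_coeff.
rewrite -(cvg_lim _ cvgc)//; apply: limr_le; first exact: cvgP cvgc.
apply: nearW => n; rewrite /series /= -big_split /=.
apply: (@le_trans _ _ (\sum_(0 <= i < n.*2) c i)).
  have nn : (n <= n.*2)%N by rewrite -addnn leq_addr.
  rewrite (big_cat_nat _ nn)//= lerDl.
  by apply: sumr_ge0 => i _; exact: c0.
by apply: le_trans (cle n) _; rewrite ler_pM2l.
Qed.

Section Concentration.
Variables (T : finType) (p : T -> R).
Hypothesis pw : is_weight p.

(* Averaging [exp (a (g t - g t'))] against an independent copy [t'] reduces
   the bound to one on cosh. *)
Lemma mgf_bounded_range (g : T -> R) (a : R) :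
  (forall t t', `|g t - g t'| <= 1) ->
  \sum_t p t * expR (a * g t) <= expR (a * (\sum_t p t * g t) + a ^+ 2 / 2).
Proof.
case: pw => p0 p1 g1; set m := \sum_t p t * g t.
(* Jensen's inequality, from the tangent line of the exponential at [- (a * m)]. *)
have jensen : expR (- (a * m)) <= \sum_t p t * expR (- (a * g t)).
  apply: (@le_trans _ _ (\sum_t p t * (expR (- (a * m)) * (1 + (a * m - a * g t))))).
    under eq_bigr do rewrite mulrCA mulrDr mulr1 mulrBr.
    rewrite -mulr_sumr big_split sumrB -mulr_suml p1 mul1r /=.
    under [X in _ - X]eq_bigr do rewrite mulrCA.
    by rewrite -mulr_sumr -/m subrr addr0 mulr1.
  apply: ler_sum => t _; apply: ler_wpM2l => //.
  rewrite [X in _ <= expR X](_ : _ = - (a * m) + (a * m - a * g t)); last by lra.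
  by rewrite expRD ler_pM2l ?expR_gt0// expR_ge1Dx.
rewrite expRD -ler_pdivrMl ?expR_gt0// -expRN.
apply: (@le_trans _ _ (\sum_t \sum_t' p t * p t' * expR (a * (g t - g t')))).
  apply: le_trans (ler_wpM2r _ jensen) _.
    by apply: sumr_ge0 => t _; rewrite mulr_ge0// expR_ge0.
  rewrite mulrC mulr_suml; apply: ler_sum => t _.
  rewrite mulr_sumr; apply: ler_sum => t' _; apply: le_of_eq.
  by rewrite mulrACA -expRD mulrBr.
rewrite -(ler_pM2l (x := 2))// mulr_natl mulr2n.
rewrite {2}exchange_big /= -big_split /=.
apply: (@le_trans _ _ (\sum_t p t * \sum_t' p t' * (2 * expR (a ^+ 2 / 2)))).
  apply: ler_sum => t _; rewrite -big_split mulr_sumr; apply: ler_sum => t' _ /=.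
  rewrite [p t' * p t]mulrC -mulrDr -mulrA; do 2! apply: ler_wpM2l => //.
  have -> : a * (g t' - g t) = - (a * (g t - g t')) by rewrite -mulrN opprB.
  apply: le_trans (expRD_expRN_le _) _; rewrite ler_pM2l// ler_expR ler_pM2r//.
  rewrite exprMn ler_piMr ?sqr_ge0// -real_normK ?num_real//.
  by rewrite expr_le1.
by rewrite -!mulr_suml p1 !mul1r.
Qed.

Variables (J : finType) (j0 : J) (f : J -> T -> R).
Hypothesis f01 : forall j t, 0 <= f j t <= 1.

Let mean j := \sum_t p t * f j t.
Let dev (c : J -> R) (s : seq T) :=
  maxover j0 (fun j => c j + \sum_(t <- s) (mean j - f j t)).

(** The martingale argument of McDiarmid, by induction: the tail is integrated with the head fixed,
    and the conditional mean [g], a function of the head alone, has oscillation at most 1, so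
    [mgf_bounded_range] applies to it. *)
Lemma mgf_dev n (c : J -> R) (a : R) :
  Eprod p n (fun s => expR (a * dev c s)) <=
  expR (a * Eprod p n (dev c) + n%:R * (a ^+ 2 / 2)).
Proof.
case: (pw) => p0 p1.
elim: n c => [|n IH] c /=; first by rewrite mul0r addr0.
have devE t s : dev c (t :: s) = dev (fun j => c j + (mean j - f j t)) s.
  by apply: eq_maxover => j; rewrite big_cons addrA.
pose g t := Eprod p n (fun s => dev c (t :: s)).
apply: (@le_trans _ _ (\sum_t p t * (expR (a * g t) * expR (n%:R * (a ^+ 2 / 2))))).
  apply: ler_sum => t _; apply: ler_wpM2l => //; rewrite -expRD /g.
  under eq_Eprod do rewrite devE.
  by under [X in a * X]eq_Eprod do rewrite devE; exact: IH.
under [leLHS]eq_bigr do rewrite mulrA.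
rewrite -mulr_suml -[n.+1%:R]natr1 mulrDl mul1r addrCA [leRHS]expRD mulrC.
apply: ler_wpM2l; first exact: expR_ge0.
apply: mgf_bounded_range.
(* Replacing the head changes each deviation by a difference of two values of [f j], which lie in
   [0, 1]. *)
suff gle t t' : g t <= g t' + 1.
  by move=> t t'; rewrite ler_norml; have := gle t t'; have := gle t' t; lra.
rewrite /g -[X in _ + X](Eprod_cst n 1 pw) -EprodD; apply: Eprod_le => // s _.
apply: maxover_le => j; rewrite big_cons.
have := maxover_ge j0 (fun j => c j + \sum_(t <- t' :: s) (mean j - f j t)) j.
rewrite -/(dev c (t' :: s)) /= big_cons.
have := f01 j t; have := f01 j t'; lra.
Qed.

(** Chernoff bound with parameter [a] itself: the exponent is at most
    [- a (e + n a) + a e + n a^2 / 2]. *)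
Lemma dev_tail n (a e : R) : 0 < a -> Eprod p n (dev (fun=> 0)) <= e ->
  Eprod p n (fun s => (e + n%:R * a < dev (fun=> 0) s)%R%:R) <=
  expR (- (n%:R * (a ^+ 2 / 2))).
Proof.
case: (pw) => p0 p1 a0 He.
apply: (@le_trans _ _ (Eprod p n (fun s => expR (- (a * (e + n%:R * a))) *
    expR (a * dev (fun=> 0) s)))).
  apply: Eprod_le => // s _; rewrite -expRD.
  case: ltrP => [lt|_]; last exact: expR_ge0.
  apply: (@le_trans _ _ (expR 0)); first by rewrite expR0.
  by rewrite ler_expR addrC subr_ge0 ler_pM2l// ltW.
rewrite EprodZ; apply: le_trans (ler_wpM2l (expR_ge0 _) (mgf_dev _ _ _)) _.
rewrite -expRD ler_expR.
have : a * Eprod p n (dev (fun=> 0)) <= a * e by rewrite ler_pM2l.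
set E := Eprod _ _ _; lra.
Qed.

End Concentration.
End FiniteProducts.

(** * Finite-valued codes of random elements, and independence *)

Section FiniteCodes.
Context d (Omega : measurableType d) (R : realType) (P : probability Omega R).

Section OneCode.
Variables (U : finType) (c : Omega -> U).
Hypothesis mc : forall u, measurable (c @^-1` [set u]).

Lemma code_preimage (A : set U) : measurable (c @^-1` A).
Proof.
have -> : c @^-1` A = \bigcup_(u in A) (c @^-1` [set u]).
  by apply/seteqP; split=> [w /= Aw|w [u Au /= ->]//]; exists (c w).
by apply: fin_bigcup_measurable => // ; exact: finite_finset.
Qed.

Lemma measurable_code d' (V : measurableType d') (phi : U -> V) :
  measurable_fun setT (phi \o c).
Proof. by move=> _ B _; rewrite setTI comp_preimage; exact: code_preimage. Qed.

Lemma integral_code (phi : U -> R) : (forall u, 0 <= phi u) ->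
  (\int[P]_w (phi (c w))%:E = \sum_u (phi u)%:E * P (c @^-1` [set u]))%E.
Proof.
move=> phi0.
transitivity (\int[P]_w (\sum_u (phi u * \1_(c @^-1` [set u]) w)%:E))%E.
  apply: eq_integral => w _; rewrite sumEFin (bigD1 (c w))//= big1.
    by rewrite indicE mem_set// mulr1 addr0.
  by move=> u /eqP uc; rewrite indicE memNset ?mulr0//= => /esym.
rewrite ge0_integral_sum//; last 2 first.
- move=> u; apply/measurable_EFinP/measurable_funM => //.
- by move=> u w _; rewrite lee_fin mulr_ge0.
apply: eq_bigr => u _; under eq_integral do rewrite EFinM.
rewrite ge0_integralZl//; last 2 first.
- exact/measurable_EFinP.
- by rewrite lee_fin.
by rewrite integral_indic// setIT.
Qed.

Lemma prob_code (Q : pred U) :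
  (P [set w | Q (c w)] = \sum_u (Q u)%:R%:E * P (c @^-1` [set u]))%E.
Proof.
rewrite -integral_code; last by move=> u; rewrite ler0n.
rewrite -[X in P X]setIT -integral_indic//; last exact: (code_preimage [set u | Q u]).
by apply: eq_integral => w _; rewrite indicE mem_setE.
Qed.

End OneCode.

Section IidCodes.
Variables (n : nat) (U : finType) (c : 'I_n -> Omega -> U) (p : U -> R).
Hypothesis mc : forall i u, measurable (c i @^-1` [set u]).
Hypothesis c_iid : forall u : 'I_n -> U,
  P (\bigcap_i (c i @^-1` [set u i])) = (\prod_i p (u i))%:E.

Definition codes w : n.-tuple U := [tuple c i w | i < n].

Lemma codes_fiber (u : n.-tuple U) :
  codes @^-1` [set u] = \bigcap_i (c i @^-1` [set tnth u i]).
Proof.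
apply/seteqP; split=> [w /= <- i _|w uw] /=; first by rewrite tnth_mktuple.
by apply: eq_from_tnth => i; rewrite tnth_mktuple; exact: uw.
Qed.

Lemma measurable_codes u : measurable (codes @^-1` [set u]).
Proof.
by rewrite codes_fiber; apply: fin_bigcap_measurable => //; exact: finite_finset.
Qed.

(** By the i.i.d. hypothesis each fibre of the joint code has product weight, so the integral is the
    finite sum of [Eprod_tuple]. *)
Lemma integral_codes (G : seq U -> R) : (forall s, 0 <= G s) ->
  (\int[P]_w (G (codes w))%:E = (Eprod p n G)%:E)%E.
Proof.
move=> G0; rewrite (integral_code measurable_codes (phi := G)) => [|u]//.
rewrite Eprod_tuple -sumEFin; apply: eq_bigr => u _.
by rewrite codes_fiber c_iid mulrC.
Qed.

Lemma prob_codes (Q : pred (seq U)) :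
  P [set w | Q (codes w)] = (Eprod p n (fun s => (Q s)%:R))%:E.
Proof.
rewrite (prob_code measurable_codes (fun u : n.-tuple U => Q u)) Eprod_tuple -sumEFin.
by apply: eq_bigr => u _; rewrite codes_fiber c_iid mulrC.
Qed.

End IidCodes.

Section Independence.
Variables (d' : measure_display) (E : measurableType d') (n : nat).
Variables (X : 'I_n -> {RV P >-> E}) (eps : 'I_n -> {RV P >-> R}).
Hypothesis XeI : mutually_independent P (fun k : 'I_n + 'I_n =>
     match k with inl i => sigma_of (X i) | inr i => sigma_of (eps i) end).

Lemma indep_rect (A : 'I_n -> set E) (B : 'I_n -> set R) :
  (forall i, measurable (A i)) -> (forall i, measurable (B i)) ->
  P (\bigcap_i (X i @^-1` A i `&` eps i @^-1` B i)) =
  (\prod_i (P (X i @^-1` A i) * P (eps i @^-1` B i)))%E.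
Proof.
move=> mA mB.
pose C (k : 'I_n + 'I_n) :=
  match k with inl i => X i @^-1` A i | inr i => eps i @^-1` B i end.
have := XeI (J := [set: 'I_n + 'I_n]%SET) (A := C).
have -> : \bigcap_(k in [set` [set: 'I_n + 'I_n]%SET]) C k =
    \bigcap_i (X i @^-1` A i `&` eps i @^-1` B i).
  apply/seteqP; split => [w Cw i _|w Cw [] i _].
  - by split; [apply: (Cw (inl i)) | apply: (Cw (inr i))]; rewrite /= finset.in_setT.
  - by have [] := Cw i.
  - by have [] := Cw i.
move=> ->.
  rewrite big_split /= (eq_bigl xpredT) => [|k]; last by rewrite finset.in_setT.
  by rewrite big_sumType.
case=> i _; [exists (A i) | exists (B i)] => //; exact: setTI.
Qed.

End Independence.
End FiniteCodes.

Import HBSimple.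

(** * Discretization by simple functions *)

Lemma measurable_maxover d (T : measurableType d) (R : realType) (J : finType)
    (j0 : J) (F : J -> T -> R) : (forall j, measurable_fun setT (F j)) ->
  measurable_fun setT (fun w => maxover j0 (F^~ w)).
Proof.
move=> mF; rewrite /maxover; elim: (index_enum J) => [|j r IH].
  by under eq_fun do rewrite big_nil; exact: mF.
by under eq_fun do rewrite big_cons; exact: measurable_maxr.
Qed.

Lemma L1_sfun d (E : measurableType d) (R : realType) (mu : probability E R)
    (f : E -> R) (theta : R) : mu.-integrable setT (EFin \o f) -> 0 < theta ->
  exists s : {sfun E >-> R}, (\int[mu]_x `|f x - s x|%:E <= theta%:E)%E.
Proof.
move=> /(approximation_sfun_integrable measurableT) [s_ [_ _ s_cvg]] theta0.
move/fine_cvgP : s_cvg => [fin /cvgrPdist_le /(_ _ theta0) near_le].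
have [N _ HN] := filterI fin near_le.
have [/= finN leN] := HN N (leqnn N); exists (s_ N).
rewrite -[leLHS](fineK finN) lee_fin; move: leN.
by rewrite sub0r normrN => /(le_trans (ler_norm _)).
Qed.

(** One code serves all the simple functions at once: it records, for each [j], the position of
    [s j x] in the finite list of values of [s j]. The number [M] bounds the lengths of all these
    lists. *)
Lemma sfun_code d (E : measurableType d) (R : realType) (J : finType)
    (s : J -> {sfun E >-> R}) :
  exists (T : finType) (tau : E -> T) (v : J -> T -> R),
    (forall t, measurable (tau @^-1` [set t])) /\
    (forall j x, s j x = v j (tau x)).
Proof.
pose l j : seq R := finmap.enum_fset (fset_set (range (s j))).
have ls j x : s j x \in l j.
  by rewrite [_ \in _]in_fset_set; [exact/mem_set/imageT | exact: fimfunP].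
pose M := \sum_j size (l j).
have lM j : (size (l j) <= M)%N by rewrite /M (bigD1 j)//= leq_addr.
pose tau x : {ffun J -> 'I_M.+1} := [ffun j => inord (index (s j x) (l j))].
exists {ffun J -> 'I_M.+1}, tau,
  (fun j (t : {ffun J -> 'I_M.+1}) => nth 0 (l j) (t j)); split=> [t|j x].
  have -> : tau @^-1` [set t] = \bigcap_j (s j @^-1`
      ([set y | inord (index y (l j)) = t j] `&` range (s j))).
    apply/seteqP; split=> [x /= <- j _|x tx] /=.
      by split; [rewrite ffunE | exists x].
    by apply/ffunP => j; rewrite ffunE; have [] := tx j I.
  apply: fin_bigcap_measurable => [|j _]; first exact: finite_finset.
  rewrite -[X in measurable X]setTI; apply: (measurable_funPT (s j)) => //.
  apply: countable_measurable => //; apply: finite_set_countable.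
  exact/finite_setIr/fimfunP.
by rewrite ffunE inordK ?nth_index// ltnS (leq_trans (index_size _ _)).
Qed.

(** * One-sided uniform deviations for a finite family of Lipschitz functionals *)

Section ProcessTail.
Context d (Omega : measurableType d) (R : realType) (P : probability Omega R).
Context d' (E : measurableType d') (mu : probability E R) (n : nat).
Variables (X : 'I_n -> {RV P >-> E}) (eps : 'I_n -> {RV P >-> R}).
Hypothesis X_law : forall i A, measurable A -> distribution P (X i) A = mu A.
Hypothesis eps_law : forall i, is_rademacher P (eps i).
Hypothesis XeI : mutually_independent P (fun k : 'I_n + 'I_n =>
     match k with inl i => sigma_of (X i) | inr i => sigma_of (eps i) end).

Lemma prob_X i A : measurable A -> P (X i @^-1` A) = mu A.
Proof. exact: X_law. Qed.

Lemma integral_X i (f : E -> R) : measurable_fun setT f -> (forall x, 0 <= f x) ->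
  (\int[P]_w (f (X i w))%:E = \int[mu]_x (f x)%:E)%E.
Proof.
move=> mf f0; rewrite -(@eq_measure_integral _ _ _ _ mu (distribution P (X i))).
  rewrite (ge0_integral_distribution (X i) (f := EFin \o f))//.
    exact/measurable_EFinP.
by move=> A mA _; exact: X_law.
Qed.

Lemma eps_sign i : {ae P, forall w, eps i w = sgb (eps i w == 1)}.
Proof.
have [e1 eN1] := eps_law i.
have m1 (r : R) : measurable (eps i @^-1` [set r]).
  by rewrite -[X in measurable X]setTI; exact: (measurable_funPT (eps i)).
exists (~` (eps i @^-1` [set 1] `|` eps i @^-1` [set -1])); split.
- by apply: measurableC; exact: measurableU.
- rewrite probability_setC; last exact: measurableU.
  rewrite measureU//; last first.
    by apply/seteqP; split => // w [/= ->] {e1 eN1} ?; exfalso; lra.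
  rewrite [X in (_ - (X + _))%E]e1 [X in (_ - (_ + X))%E]eN1 -EFinD.
  rewrite (_ : 2^-1 + 2^-1 = 1 :> R); first by rewrite subrr.
  by move=> {e1 eN1}; lra.
- move=> w /= H /= [] He; apply: H; rewrite He /sgb ?eqxx//.
  by case: eqP => // ->.
Qed.

Variables (J : finType) (j0 : J) (g : J -> E -> R) (psi : R -> R).
Variables (L C : R) (m : J -> R).
Hypothesis g_int : forall j, mu.-integrable setT (EFin \o g j).
Hypothesis g_j0 : forall x, g j0 x = 0.
Hypothesis psi01 : forall y, 0 <= psi y <= 1.
Hypothesis psi_lip : forall x y, `|psi x - psi y| <= L * `|x - y|.
Hypothesis mpsi : measurable_fun setT psi.
Hypothesis m_le : forall j, ((m j)%:E <= \int[mu]_x (psi (g j x))%:E)%E.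
Hypothesis rad_le :
  (\int[P]_w (maxover j0 (fun j => \sum_i eps i w * g j (X i w)))%:E <= C%:E)%E.

Let L0 : 0 <= L.
Proof. by have := psi_lip 1 0; rewrite subr0 normr1 mulr1; exact: le_trans. Qed.

Let mg j : measurable_fun setT (g j).
Proof. by apply/measurable_EFinP; have /integrableP[] := g_int j. Qed.

Section WithCode.
Variables (T : finType) (tau : E -> T) (v : J -> T -> R) (theta : R).
Hypothesis mtau : forall t, measurable (tau @^-1` [set t]).
Hypothesis v_j0 : forall t, v j0 t = 0.
Hypothesis v_approx : forall j,
  (\int[mu]_x `|g j x - v j (tau x)|%:E <= theta%:E)%E.

Let p t := fine (mu (tau @^-1` [set t])).

Let pE t : (p t)%:E = mu (tau @^-1` [set t]).
Proof. by rewrite fineK// fin_num_measure. Qed.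

Let pw : is_weight p.
Proof.
split=> [t|]; first by rewrite fine_ge0.
apply: EFin_inj; rewrite -sumEFin; under eq_bigr do rewrite pE -[mu _]mul1e.
rewrite -(prob_code mu mtau predT) -[RHS](probability_setT mu).
by congr (mu _); apply/seteqP; split.
Qed.

Let mX i t : measurable ((tau \o X i) @^-1` [set t]).
Proof.
by rewrite comp_preimage -[X in measurable X]setTI; exact: (measurable_funPT (X i)).
Qed.

Let codes_iid (u : 'I_n -> T) :
  P (\bigcap_i ((tau \o X i) @^-1` [set u i])) = (\prod_i p (u i))%:E.
Proof.
have := indep_rect XeI (A := fun i => tau @^-1` [set u i]) (B := fun=> setT).
rewrite (eq_bigcapr (fun i _ => setIT _)) => -> //.
rewrite -prodEFin; apply: eq_bigr => i _.
by rewrite preimage_setT probability_setT mule1 prob_X// pE.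
Qed.

Let signed_code i w : T * bool := (tau (X i w), eps i w == 1).

Let signed_fiber i t b : signed_code i @^-1` [set (t, b)] =
  X i @^-1` (tau @^-1` [set t]) `&` eps i @^-1` (if b then [set 1] else ~` [set 1]).
Proof.
apply/seteqP; split => w /=.
  by move=> [<- <-]; split => //; case: eqP.
by rewrite /signed_code; case: b => -[<-] /eqP => [->|/negbTE ->].
Qed.

Let mB (b : bool) : measurable (if b then [set 1] else ~` [set 1] : set R).
Proof. by case: b => //; exact: measurableC. Qed.

Let msigned i u : measurable (signed_code i @^-1` [set u]).
Proof.
case: u => t b; rewrite signed_fiber; apply: measurableI; first exact: mX.
by rewrite -[X in measurable X]setTI; exact: (measurable_funPT (eps i)).
Qed.

Let signed_iid (u : 'I_n -> T * bool) :
  P (\bigcap_i (signed_code i @^-1` [set u i])) =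
  (\prod_i signed_weight p (u i))%:E.
Proof.
rewrite (eq_bigcapr (G := fun i => X i @^-1` (tau @^-1` [set (u i).1]) `&`
    eps i @^-1` (if (u i).2 then [set 1] else ~` [set 1]))); last first.
  by move=> i _; rewrite -signed_fiber -surjective_pairing.
rewrite (indep_rect XeI (A := fun i => tau @^-1` [set (u i).1])
  (B := fun i => if (u i).2 then [set 1] else ~` [set 1]))//.
rewrite -prodEFin; apply: eq_bigr => i _; rewrite prob_X// -pE /signed_weight EFinM.
congr (_ * _)%E; have [e1 _] := eps_law i; case: (u i).2 => //.
rewrite /= -/(~` (eps i @^-1` [set 1])) probability_setC ?[P _]e1; last first.
  by rewrite -[X in measurable X]setTI; exact: (measurable_funPT (eps i)).
by rewrite -EFinB; congr EFin; lra.
Qed.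

(** The discretization error, summed over [J] so that one random variable controls every index. *)
Let D x : R := \sum_j `|g j x - v j (tau x)|.

Let mD1 j : measurable_fun setT (fun x => `|g j x - v j (tau x)|).
Proof.
apply: (measurableT_comp (@normr_measurable R setT)).
by apply: measurable_funB => //; exact: (measurable_code mtau).
Qed.

Let mD : measurable_fun setT D.
Proof. exact: measurable_sum. Qed.

Let D0 x : 0 <= D x.
Proof. exact: sumr_ge0. Qed.

Let D_int : (\int[mu]_x (D x)%:E <= (#|J|%:R * theta)%:E)%E.
Proof.
rewrite /D; under eq_integral do rewrite -sumEFin.
rewrite ge0_integral_sum//; last first.
  by move=> j; apply/measurable_EFinP.
apply: (@le_trans _ _ (\sum_(j : J) theta%:E)%E); first exact: lee_sum.
by rewrite sumEFin sumr_const mulr_natl.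
Qed.

Let DX w : R := \sum_i D (X i w).

Let mDX : measurable_fun setT DX.
Proof.
by apply: measurable_sum => i; apply: (measurableT_comp mD); exact: measurable_funPT.
Qed.

Let DX_int : (\int[P]_w (DX w)%:E <= (n%:R * (#|J|%:R * theta))%:E)%E.
Proof.
rewrite /DX; under eq_integral do rewrite -sumEFin.
rewrite ge0_integral_sum//; last 2 first.
- move=> i; apply/measurable_EFinP; apply: (measurableT_comp mD).
  exact: measurable_funPT.
- by move=> i w _; rewrite lee_fin.
apply: (@le_trans _ _ (\sum_(i < n) (#|J|%:R * theta)%:E)%E).
  by apply: lee_sum => i _; rewrite integral_X.
by rewrite sumEFin sumr_const card_ord -[_ *+ n]mulr_natl.
Qed.

Let mean j := \sum_t p t * psi (v j t).

(** The Lipschitz property of [psi] turns the L1 error [theta] of the approximation into an error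
    [L * theta] on the mean. *)
Let m_le_mean j : m j <= mean j + L * theta.
Proof.
rewrite -lee_fin; apply: (le_trans (m_le j)).
have meanE : (\int[mu]_x (psi (v j (tau x)))%:E = (mean j)%:E)%E.
  rewrite (integral_code mu mtau (phi := fun t => psi (v j t))).
    by rewrite -sumEFin; apply: eq_bigr => t _; rewrite -pE muleC.
  by move=> t; have /andP[] := psi01 (v j t).
rewrite EFinD -meanE.
have psi0 y : 0 <= psi y by have /andP[] := psi01 y.
have mpsiv : measurable_fun setT (fun x => (psi (v j (tau x)))%:E).
  by apply/measurable_EFinP; exact: (measurable_code mtau (fun t => psi (v j t))).
apply: (@le_trans _ _ (\int[mu]_x ((psi (v j (tau x)))%:E +
    L%:E * `|g j x - v j (tau x)|%:E))%E).
  apply: ge0_le_integral => //.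
  - by move=> x _; rewrite lee_fin.
  - by apply/measurable_EFinP; exact: measurableT_comp.
  - apply: emeasurable_funD => //; apply/measurable_EFinP.
    by apply: measurable_funM => //.
  - move=> x _; rewrite -EFinM -EFinD lee_fin -lerBlDl.
    exact: le_trans (ler_norm _) (psi_lip _ _).
rewrite ge0_integralD//; last 3 first.
- by move=> x _; rewrite lee_fin.
- by move=> x _; rewrite -EFinM lee_fin mulr_ge0.
- by apply/measurable_EFinP/measurable_funM.
rewrite leeD2l// ge0_integralZl_EFin//; last by apply/measurable_EFinP.
by rewrite EFinM lee_wpmul2l.
Qed.

(** Almost surely [eps i] is the sign given by its code, and exchanging [v] for [g] costs at most
    [DX], whose mean is small; the remaining Rademacher average is bounded by [C]. *)
Let R_bound : 2 * L * Eprod (signed_weight p) n (fun s =>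
    maxover j0 (fun j => \sum_(u <- s) sgb u.2 * v j u.1)) <=
  2 * L * (C + n%:R * (#|J|%:R * theta)).
Proof.
apply: ler_wpM2l; first by rewrite mulr_ge0.
set G := fun s => _.
(* The index [j0] contributes 0, so the maximum is nonnegative. *)
have G0 s : 0 <= G s.
  apply: le_trans (maxover_ge _ _ j0).
  by rewrite big1// => u _; rewrite v_j0 mulr0.
rewrite -lee_fin -(integral_codes msigned signed_iid G0).
pose Z w := maxover j0 (fun j => \sum_i eps i w * g j (X i w)).
have Z0 w : 0 <= Z w.
  apply: le_trans (maxover_ge _ _ j0).
  by rewrite big1// => i _; rewrite g_j0 mulr0.
have mZ : measurable_fun setT Z.
  apply: measurable_maxover => j; apply: measurable_sum => i.
  apply: measurable_funM; first exact: measurable_funPT.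
  by apply: (measurableT_comp (mg j)); exact: measurable_funPT.
rewrite EFinD; apply: le_trans (leeD rad_le DX_int).
rewrite -ge0_integralD//; last 4 first.
- by move=> w _; rewrite lee_fin Z0.
- exact/measurable_EFinP.
- by move=> w _; rewrite lee_fin; apply: sumr_ge0.
- exact/measurable_EFinP.
apply: ae_ge0_le_integral => //.
- by move=> w _; rewrite lee_fin.
- apply/measurable_EFinP.
  exact: (measurable_code (measurable_codes msigned) (fun u : n.-tuple _ => G u)).
- by move=> w _; rewrite lee_fin; apply: addr_ge0; [exact: Z0|exact: sumr_ge0].
- by apply/measurable_EFinP; exact: measurable_funD.
have signs : {ae P, forall w, forall i, eps i w = sgb (eps i w == 1)}.
  by apply: filter_forall; exact: eps_sign.
apply: filterS signs => w sw _; rewrite -EFinD lee_fin.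
apply: maxover_le => j.
have := maxover_ge j0 (fun j => \sum_i eps i w * g j (X i w)) j.
rewrite -/(Z w) => /= Zj.
have -> : \sum_(u <- codes signed_code w) sgb u.2 * v j u.1 =
    \sum_i sgb (eps i w == 1) * v j (tau (X i w)).
  by rewrite big_tuple; apply: eq_bigr => i _; rewrite tnth_mktuple.
apply: le_trans (lerD Zj (lexx _)); rewrite -lerBlDl -sumrB.
apply: ler_sum => i _; rewrite [X in _ - X * _](sw i) -mulrBr.
apply: (@le_trans _ _ `|g j (X i w) - v j (tau (X i w))|).
  rewrite distrC; apply: le_trans (ler_norm _) _; rewrite normrM.
  by rewrite /sgb; case: ifP => _; rewrite ?normrN normr1 mul1r.
by rewrite /D (bigD1 j)//= lerDl sumr_ge0.
Qed.

(** The exceptional set is the union of two: the concentration bound fails for the codes, or the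
    total discretization error [DX] exceeds [c], which Markov's inequality controls. Outside it,
    going back from codes to [g] costs [L * theta] per observation for the means and [L * c] for the
    sample. *)
Lemma process_tail_code (a c : R) : 0 < a -> 0 < c ->
  exists B : set Omega, [/\ measurable B,
    (P B <= (expR (- (n%:R * (a ^+ 2 / 2))) + n%:R * (#|J|%:R * theta) / c)%:E)%E &
    forall w, ~ B w -> forall j, \sum_i (m j - psi (g j (X i w))) <=
      2 * L * C + n%:R * a + (n%:R * L + 2 * L * n%:R * #|J|%:R) * theta + L * c].
Proof.
move=> a0 c0.
pose f j t := psi (v j t).
pose e := 2 * L * (C + n%:R * (#|J|%:R * theta)).
pose dev (s : seq T) := maxover j0 (fun j => 0 + \sum_(t <- s) (mean j - f j t)).
have dev_e : Eprod p n dev <= e.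
  apply: le_trans R_bound; rewrite -EprodZ.
  have fL j k t : `|f j t - f k t| <= L * `|v j t - v k t| by exact: psi_lip.
  apply: le_trans (symmetrize j0 pw fL n (fun=> 0)) _.
  apply: Eprod_le => [u|s _]; first by case: (signed_weightP pw).
  apply: maxover_le => j; rewrite add0r; apply: ler_wpM2l; first by rewrite mulr_ge0.
  exact: (maxover_ge j0 (fun j => \sum_(u <- s) sgb u.2 * v j u.1)).
have f01 j t : 0 <= f j t <= 1 by exact: psi01.
have tail := dev_tail pw f01 a0 dev_e.
pose Q (s : seq T) := e + n%:R * a < dev s.
pose A := [set w | Q (codes (fun i => tau \o X i) w)].
have mA : measurable A.
  exact: (code_preimage (measurable_codes mX) [set u : n.-tuple T | Q u]).
have PA : (P A <= (expR (- (n%:R * (a ^+ 2 / 2))))%:E)%E.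
  by rewrite /A (prob_codes mX codes_iid) lee_fin.
pose B := [set w | c < DX w].
have mB' : measurable B.
  have -> : B = setT `&` DX @^-1` `]c, +oo[%classic.
    by apply/seteqP; split=> w; rewrite /= in_itv/= andbT => // -[].
  exact: mDX.
have PB : (P B <= (n%:R * (#|J|%:R * theta) / c)%:E)%E.
  rewrite mulrC EFinM lee_pdivlMl//; apply: le_trans DX_int.
  rewrite -[X in P X]setIT -integral_indic// -ge0_integralZl_EFin//; last 2 first.
  - exact/measurable_EFinP.
  - exact: ltW.
  apply: ge0_le_integral => //.
  - by move=> w _; rewrite -EFinM lee_fin mulr_ge0// ltW.
  - by apply/measurable_EFinP/measurable_funM.
  - exact/measurable_EFinP.
  - move=> w _; rewrite -EFinM lee_fin indicE; case: (boolP (w \in B)) => [/set_mem/ltW|_].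
      by rewrite mulr1.
    by rewrite mulr0; apply: sumr_ge0.
exists (A `|` B); split.
- exact: measurableU.
- by rewrite EFinD; apply: le_trans (measureU2 P mA mB') _; exact: leeD.
move=> w /not_orP[/negP nA /negP nB] j; move: nA nB; rewrite -!leNgt => nA nB.
have devj : \sum_i (mean j - psi (v j (tau (X i w)))) <= e + n%:R * a.
  apply: le_trans nA.
  apply: le_trans (maxover_ge j0 (fun j => 0 + \sum_(t <- _) (mean j - f j t)) j).
  rewrite add0r /codes big_tuple; apply: le_of_eq; apply: eq_bigr => i _.
  by rewrite tnth_mktuple.
apply: (@le_trans _ _ (\sum_i ((mean j - psi (v j (tau (X i w)))) +
    (L * theta + L * D (X i w))))).
  apply: ler_sum => i _.
  have : psi (v j (tau (X i w))) - psi (g j (X i w)) <= L * D (X i w).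
    apply: le_trans (ler_norm _) _; rewrite distrC; apply: le_trans (psi_lip _ _) _.
    by apply: ler_wpM2l => //; rewrite /D (bigD1 j)//= lerDl sumr_ge0.
  have := m_le_mean j.
  move: (psi _) (psi _) (L * D _) (L * theta) (mean j) (m j) => *; lra.
rewrite big_split [X in _ + X <= _]big_split /= -!mulr_sumr sumr_const card_ord.
rewrite -[theta *+ n]mulr_natl.
have : L * \sum_i D (X i w) <= L * c by apply: ler_wpM2l.
move: devj; rewrite /e.
move: (\sum_i _) (L * \sum_i _) (L * c) => S1 S2 S3 *; lra.
Qed.

End WithCode.

(** Density of simple functions in L1: [theta] can be chosen after [c], so every discretization
    error fits into [eta]. *)
Lemma process_tail (a eta : R) : 0 < a -> 0 < eta ->
  exists B : set Omega, [/\ measurable B,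
    (P B <= (expR (- (n%:R * (a ^+ 2 / 2))) + eta)%:E)%E &
    forall w, ~ B w -> forall j, \sum_i (m j - psi (g j (X i w))) <=
      2 * L * C + n%:R * a + eta].
Proof.
move=> a0 eta0.
(* The sum of the coefficients of [theta] in the two error terms, before division by [c] in the
   probability; the summand 1 keeps it positive. *)
pose K := n%:R * L + 2 * L * n%:R * #|J|%:R + n%:R * #|J|%:R + 1.
have nJ0 : 0 <= n%:R * #|J|%:R :> R by rewrite mulr_ge0.
have nL0 : 0 <= n%:R * L by rewrite mulr_ge0.
have nLJ0 : 0 <= 2 * L * n%:R * #|J|%:R.
  by rewrite -mulrA mulr_ge0// mulr_ge0.
have K0 : 0 < K by rewrite /K; lra.
(* This gives [L * c <= eta / 2], and [L + 1] avoids a division by zero. *)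
pose c := eta / (2 * (L + 1)).
have c0 : 0 < c by rewrite divr_gt0// mulr_gt0// ltr_pwDr.
pose theta := Num.min (eta / 2) (eta * c) / K.
have theta0 : 0 < theta.
  by rewrite divr_gt0// lt_min divr_gt0//= mulr_gt0.
have [s_ s_approx] := choice (fun j => L1_sfun (g_int j) theta0).
have [T [tau [v [mtau sE]]]] := sfun_code s_.
(* The approximant at [j0] is replaced by 0, the exact value of [g j0]. *)
pose v' j t := if j == j0 then 0 else v j t.
have v'_j0 t : v' j0 t = 0 by rewrite /v' eqxx.
have v'_approx j : (\int[mu]_x `|g j x - v' j (tau x)|%:E <= theta%:E)%E.
  rewrite /v'; case: eqP => [->|_].
    under eq_integral do rewrite g_j0 subr0 normr0.
    by rewrite integral0 lee_fin ltW.
  by under eq_integral do rewrite -sE.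
have [B [mB PB HB]] := process_tail_code mtau v'_j0 v'_approx a0 c0.
have thetaK : theta * K = Num.min (eta / 2) (eta * c) by rewrite divfK// gt_eqF.
have th1 : theta * K <= eta / 2 by rewrite thetaK ge_min lexx.
have th2 : theta * K <= eta * c by rewrite thetaK ge_min lexx orbT.
exists B; split=> //.
  apply: le_trans PB _; rewrite lee_fin lerD2l ler_pdivrMr//.
  apply: le_trans th2; rewrite /K; nra.
move=> w nBw j; apply: le_trans (HB w nBw j) _.
have cL : L * c <= eta / 2.
  rewrite /c mulrCA ler_pM2l// invfM mulrCA ler_piMr//.
  by rewrite ler_pdivrMr ?mul1r ?lerDl// ltr_pwDr.
have : (n%:R * L + 2 * L * n%:R * #|J|%:R) * theta <= eta / 2.
  apply: le_trans th1; rewrite /K; nra.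
lra.
Qed.

End ProcessTail.

(* No measurability is assumed: the Rademacher supremum over a localized ball is an
   uncountable one. *)
Lemma ge0_le_integralT d (T : measurableType d) (R : realType)
    (mu : {measure set T -> \bar R}) (f g : T -> \bar R) :
  (forall x, 0 <= f x)%E -> (forall x, f x <= g x)%E ->
  (\int[mu]_x f x <= \int[mu]_x g x)%E.
Proof.
move=> f0 fg; have g0 x : (0 <= g x)%E by exact: le_trans (f0 x) (fg x).
rewrite !ge0_integralTE//; apply: le_ereal_sup => _ [h hf <-]; exists h => // x.
exact: le_trans (hf x) (fg x).
Qed.

(** * Inner product inequalities and general norms *)

Section HilbertSpace.
Context {R : realType} {H : completeNormedModType R}.
Variable dot : {dot H for idfun}.
Hypothesis dotE : hilbertian dot.

Lemma dotC x y : dot x y = dot y x.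
Proof. by rewrite [LHS]hermC expr0 mul1r. Qed.

Lemma dotZl a x y : dot (a *: x) y = a * dot x y.
Proof. by rewrite linearZl_LR. Qed.

Lemma dotZr a x y : dot x (a *: y) = a * dot x y.
Proof. by rewrite linearZr_LR. Qed.

Lemma cauchy_schwarz x y : `|dot x y| <= `|x| * `|y|.
Proof.
have [->|y0] := eqVneq y 0; first by rewrite linear0r !normr0 mulr0.
have yy : 0 < `|y| ^+ 2 by rewrite exprn_gt0// normr_gt0.
pose t := dot x y / `|y| ^+ 2.
have : 0 <= dot (x - t *: y) (x - t *: y) by rewrite dotE sqr_ge0.
rewrite linearBl !linearBr /= !dotZl !dotZr !dotE (dotC y x).
have -> : `|x| ^+ 2 - t * dot x y - (t * dot x y - t * (t * `|y| ^+ 2)) =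
    `|x| ^+ 2 - (dot x y) ^+ 2 / `|y| ^+ 2.
  by rewrite /t; field; rewrite normr_eq0.
rewrite subr_ge0 ler_pdivrMr// -exprMn => le2.
by rewrite -ler_sqr ?nnegrE ?mulr_ge0// real_normK ?num_real.
Qed.

Lemma measurable_dot h : measurable_fun [set: borel H] (fun x : borel H => dot x h).
Proof.
apply: (measurability _ (RGenOpens.measurableE R)) => _ [_ [a [b ->]] <-].
rewrite setTI; apply: sub_sigma_algebra.
apply: open_comp; last exact: interval_open.
move=> x _; apply/(@cvgrPdist_lt _ R^o) => e e0; near=> y.
rewrite /= -linearBl /=; apply: le_lt_trans (cauchy_schwarz _ _) _.
rewrite (@le_lt_trans _ _ (`|x - y| * (`|h| + 1)))//.
  by rewrite ler_wpM2l// lerDl.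
rewrite -ltr_pdivlMr ?ltr_pwDr//; near: y.
by apply: cvgr_dist_lt; rewrite ?divr_gt0// ltr_pwDr.
Unshelve. all: by end_near. Qed.

End HilbertSpace.

Section Norms.
Context {R : realType} {H : lmodType R} {N : H -> R}.
Hypothesis N_norm : is_norm N.

Lemma is_norm00 : N 0 = 0.
Proof. by rewrite -(scale0r 0) (is_normZ N_norm) normr0 mul0r. Qed.

Lemma is_normN x : N (- x) = N x.
Proof. by rewrite -scaleN1r (is_normZ N_norm) normrN normr1 mul1r. Qed.

Lemma is_norm_ge0 x : 0 <= N x.
Proof.
have := is_normD N_norm x (- x); rewrite subrr is_norm00 is_normN; lra.
Qed.

Lemma is_norm_gt0 x : x <> 0 -> 0 < N x.
Proof.
by move=> x0; rewrite lt_neqAle is_norm_ge0 andbT eq_sym; apply/eqP => /(is_norm0 N_norm).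
Qed.

End Norms.

(** * The L2 norm under the small-ball assumption *)

Section L2.
Context {R : realType} {H : completeNormedModType R}.
Variables (dot : {dot H for idfun}) (mu : probability (borel H) R).
Variables (kappa delta : R).
Hypotheses (dotE : hilbertian dot) (kappa_gt0 : 0 < kappa) (delta_gt0 : 0 < delta).
Hypothesis sb : small_ball dot mu kappa delta.

Definition l2 (h : H) : R := fine (L2norm dot mu h).

(** If the norm were infinite, the small-ball event would be empty, yet its measure is at least
    [delta > 0]. *)
Lemma L2norm_fin h : L2norm dot mu h = (l2 h)%:E.
Proof.
rewrite fineK// ge0_fin_numE ?Lnorm_ge0// ltey; apply/eqP => oo.
have := sb h; rewrite oo; rewrite gt0_muley ?lte_fin//.
rewrite (_ : [set _ | _] = set0) ?measure0 ?lee_fin ?leNgt ?delta_gt0//.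
by apply/seteqP; split=> x //=; rewrite leye_eq.
Qed.

Lemma l2_ge0 h : 0 <= l2 h.
Proof. by rewrite fine_ge0// Lnorm_ge0. Qed.

Lemma l2_sqr h : ((l2 h) ^+ 2)%:E = (\int[mu]_x (dot x h ^+ 2)%:E)%E.
Proof.
have := @poweR_Lnorm _ _ _ mu (fun x : borel H => (dot x h)%:E) 2 ltac:(by []).
rewrite -/(L2norm dot mu h) L2norm_fin poweR_EFin powR_mulrn ?l2_ge0// => ->.
apply: eq_integral => x _; rewrite abse_EFin poweR_EFin powR_mulrn//.
by rewrite real_normK ?num_real.
Qed.

Lemma l2Z a h : l2 (a *: h) = `|a| * l2 h.
Proof.
apply/eqP; rewrite -(eqrXn2 (n := 2))// ?mulr_ge0 ?l2_ge0//; apply/eqP/EFin_inj.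
rewrite l2_sqr exprMn EFinM l2_sqr -ge0_integralZl_EFin//.
- by apply: eq_integral => x _; rewrite /= dotZr exprMn EFinM real_normK ?num_real.
- by move=> x _; rewrite lee_fin sqr_ge0.
- by apply/measurable_EFinP/measurable_funX; exact: measurable_dot.
Qed.

Lemma l20 : l2 0 = 0.
Proof. by rewrite -(scale0r 0) l2Z normr0 mul0r. Qed.

Lemma integrable_dot h : mu.-integrable setT (EFin \o (fun x : borel H => dot x h)).
Proof.
have mh := measurable_dot dotE h.
apply/integrableP; split; first exact/measurable_EFinP.
apply: (@le_lt_trans _ _ (\int[mu]_x (1 + dot x h ^+ 2)%:E)%E).
  apply: ge0_le_integralT => x; rewrite lee_fin//.
  have [a b] := (sqr_ge0 (`|dot x h| - 1), real_normK (num_real (dot x h))).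
  rewrite -[in leRHS]b; nra.
under eq_integral do rewrite EFinD.
rewrite ge0_integralD//; last 2 first.
- by move=> x _; rewrite lee_fin sqr_ge0.
- exact/measurable_EFinP/measurable_funX.
rewrite integral_cst//= -l2_sqr probability_setT mule1.
by rewrite -EFinD ltry.
Qed.

Lemma small_ball_l2 h :
  (delta%:E <= mu [set x : borel H | (kappa * l2 h <= `|dot x h|)%R])%E.
Proof.
have := sb h; rewrite L2norm_fin.
by under eq_set do rewrite -EFinM lee_fin.
Qed.

End L2.

Lemma maxover_eq (R : realType) (J : finType) (j0 : J) (c : J -> R) :
  exists j, maxover j0 c = c j.
Proof.
rewrite /maxover; elim/big_ind: _ => [|x y [i ->] [j ->]|i _]; last by exists i.
  by exists j0.
by rewrite maxEle; case: ifP => _; [exists j | exists i].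
Qed.

Lemma cvg_lee (R : realType) (u : (\bar R)^nat) (c l : \bar R) :
  u @ \oo --> l -> (forall n, c <= u n)%E -> (c <= l)%E.
Proof.
move=> ul cu; rewrite -(cvg_lim _ ul)//; apply: lime_ge; first exact: cvgP ul.
exact: nearW.
Qed.

(** * The Lipschitz surrogate for an indicator *)

Section Ramp.
Context {R : realType}.

(** For [c > 0] it is 0 when [|y| <= 1 / c], 1 when [|y| >= 2 / c], and affine in [|y|] in
    between. *)
Definition ramp (c y : R) : R := Num.max 0 (Num.min 1 (c * `|y| - 1)).

Lemma ramp01 c y : 0 <= ramp c y <= 1.
Proof. by rewrite /ramp le_max lexx/= ge_max ler01/= ge_min lexx. Qed.

Lemma ramp_lip c x y : 0 <= c -> `|ramp c x - ramp c y| <= c * `|x - y|.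
Proof.
move=> c0; have xy : `|c * `|x| - c * `|y| | <= c * `|x - y|.
  by rewrite -mulrBr normrM (ger0_norm c0) ler_wpM2l// ler_dist_dist.
apply: le_trans xy; rewrite /ramp; move: (c * `|x|) (c * `|y|) => u v.
have := ler_norm (u - v); have := ler_norm (v - u); rewrite (distrC v u) ler_norml.
case: (leP 1 (u - 1)) => ?; case: (leP 1 (v - 1)) => ?;
  rewrite ?(max_r ler01); case: (leP 0 (u - 1)) => ?; case: (leP 0 (v - 1)) => ?; lra.
Qed.

Lemma ramp1 c y : 2 <= c * `|y| -> ramp c y = 1.
Proof.
by move=> ?; rewrite /ramp min_l ?max_r//; lra.
Qed.

Lemma ramp_le_sqr c y : ramp c y <= c ^+ 2 * y ^+ 2.
Proof.
rewrite /ramp ge_max -exprMn sqr_ge0/= ge_min; apply/orP; right.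
rewrite -[leRHS]real_normK ?num_real// normrM.
have : c * `|y| <= `|c| * `|y| by rewrite ler_wpM2r// ler_norm.
by move: (c * `|y|) (`|c| * `|y|) => u v ?; nra.
Qed.

Lemma measurable_ramp c : measurable_fun setT (ramp c).
Proof.
apply: measurable_maxr => //; apply: measurable_minr => //.
by apply: measurable_funB => //; apply: measurable_funM.
Qed.

End Ramp.

(* A countable family which approximates every element of [K] when tested
   against [n] vectors of the closure of the countable set [D]; no topology on
   [K] itself is involved. *)
Lemma countable_weak_approx (R : realType) (H : completeNormedModType R)
    (dot : {dot H for idfun}) (K D : set H) (n : nat) :
  hilbertian dot -> K !=set0 -> countable D -> D !=set0 ->
  exists hseq : nat -> H, (forall k, K (hseq k)) /\
    forall (x : 'I_n -> H), (forall i, closure D (x i)) ->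
    forall h e, K h -> 0 < e ->
    exists k, forall i, `|dot (x i) h - dot (x i) (hseq k)| < e.
Proof.
move=> dotE [h0 Kh0] /pfcard_geP[->|[f]] [d0 Dd0]; first by case: Dd0.
(* An index holds a bound on the Hilbert norm, [n] points of [D] and [n] rational intervals. Each
   index selects one element of [K] satisfying these constraints, or any element of [K] if there is
   none. *)
pose I := (nat * n.-tuple nat * n.-tuple (rat * rat))%type.
pose good (u : I) (h : H) := [/\ K h, `|h| <= u.1.1%:R &
  forall i, ratr (tnth u.2 i).1 < dot (f (tnth u.1.2 i)) h < ratr (tnth u.2 i).2].
have /choice[sel selP] (u : I) : exists h', K h' /\ ((exists h, good u h) -> good u h').
  have [[h hu]|nh] := pselect (exists h, good u h).
    by exists h; split => //; case: hu.
  by exists h0; split.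
exists (fun k => if unpickle k is Some u then sel u else h0); split=> [k|x Dx h e Kh e0].
  by case: (unpickle k) => // u; have [] := selP u.
pose m := (Num.bound `|h|).
have hm : `|h| <= m%:R by exact/ltW/archi_boundP.
(* Moving [x i] to a point of [D] within [eta] changes its product with a vector of norm at most [m]
   by at most [e / 4]; this occurs twice, and the rational interval accounts for [e / 2]. *)
pose eta := e / (4 * (m%:R + 1)).
have eta0 : 0 < eta by rewrite divr_gt0// mulr_gt0// ltr_wpDl.
have /choice[a aP] i : exists a, `|x i - f a| < eta.
  have [y [Dy /=]] := Dx i _ (nbhsx_ballx (x i) eta eta0).
  rewrite -ball_normE /= => xy.
  by have [a _ fa] := 'surj_f Dy; exists a; rewrite fa.
have /choice[q qP] i : exists q : rat * rat,
    [/\ ratr q.1 < dot (f (a i)) h, dot (f (a i)) h < ratr q.2 &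
        ratr q.2 - ratr q.1 < e / 2 :> R].
  have [q1 /[!in_itv]/= /andP[q1l q1u]] := @rat_in_itvoo R
    (dot (f (a i)) h - e / 4) (dot (f (a i)) h) ltac:(lra).
  have [q2 /[!in_itv]/= /andP[q2l q2u]] := @rat_in_itvoo R
    (dot (f (a i)) h) (dot (f (a i)) h + e / 4) ltac:(lra).
  by exists (q1, q2); split => //=; lra.
pose u : I := (m, [tuple a i | i < n], [tuple q i | i < n]).
have [_ []] := selP u.
  exists h; split => //= i; rewrite !tnth_mktuple.
  by have [-> -> _] := qP i.
move=> Ksel /= selm selq.
exists (pickle u) => i; rewrite pickleK.
have := selq i; rewrite !tnth_mktuple => /andP[s1 s2].
have [h1 h2 h12] := qP i.
have cs z : `|z| <= m%:R -> `|dot (x i) z - dot (f (a i)) z| <= e / 4.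
  move=> zm; rewrite -linearBl /=; apply: le_trans (cauchy_schwarz dotE _ _) _.
  apply: (@le_trans _ _ (eta * (m%:R + 1))).
    by apply: ler_pM => //; [exact: ltW | lra].
  by rewrite /eta invfM mulrA divfK// gt_eqF// ltr_wpDl.
have := cs _ hm; have := cs _ selm.
rewrite !ler_norml ltr_norml => /andP[? ?] /andP[? ?].
by apply/andP; split; lra.
Qed.

(** * The uniform lower bound on the empirical second moment *)

Section SmallBallMethod.
Context (R : realType) (H : completeNormedModType R).
Variables (dot : {dot H for idfun}) (N : H -> R) (mu : probability (borel H) R).
Context (d : measure_display) (Omega : measurableType d) (P : probability Omega R).
Variables (n : nat) (X : 'I_n -> {RV P >-> borel H}) (eps : 'I_n -> {RV P >-> R}).
Variables (kappa delta gamma : R).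
Hypotheses (dotE : hilbertian dot) (N_norm : is_norm N) (n_gt0 : (0 < n)%N).
Hypothesis X_law : forall i A, measurable A -> distribution P (X i) A = mu A.
Hypothesis eps_law : forall i, is_rademacher P (eps i).
Hypothesis XeI : mutually_independent P (fun k : 'I_n + 'I_n =>
     match k with inl i => sigma_of (X i) | inr i => sigma_of (eps i) end).
Hypotheses (kappa_gt0 : 0 < kappa) (delta_gt0 : 0 < delta).
Hypothesis sb : small_ball dot mu kappa delta.
Hypothesis gammaE : gamma = kappa * delta / 32.

Let l := l2 dot mu.
Let pfail := 2 * expR (- (delta ^+ 2 * n%:R / 16)).

(** Here [r] stands for the L2 norm of [h]. *)
Definition lower_isometry (r : R) (w : Omega) (h : H) : Prop :=
  n%:R * (delta * kappa ^+ 2 / 8) * r ^+ 2 <= \sum_i dot (X i w) h ^+ 2.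

Section FixedRadius.
Variable r : R.
Hypothesis r_gt0 : 0 < r.
Hypothesis r_rad :
  (rademacher_complexity dot N mu X eps r <= (gamma * n%:R * r)%:E)%E.

Lemma finite_lower_isometry (J : finType) (h : J -> H) :
  (forall j, l (h j) = r) -> (forall j, N (h j) <= 1) ->
  exists B, [/\ measurable B, (P B <= pfail%:E)%E &
    forall w, ~ B w -> forall j, lower_isometry r w (h j)].
Proof.
move=> lh Nh.
(* The added index [None] carries the zero vector and plays the part of [j0] in [process_tail]. *)
pose h' (o : option J) : H := if o is Some j then h j else 0.
pose g (o : option J) (x : borel H) := dot x (h' o).
(* With this slope the ramp equals 1 exactly from [|y| = kappa * r] on, the small-ball threshold. *)
pose c := 2 / (kappa * r).
have c0 : 0 < c by rewrite divr_gt0// mulr_gt0.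
pose m (o : option J) := if o is Some j then delta else 0.
have n0 : 0 < n%:R :> R by rewrite ltr0n.
have g_int o : mu.-integrable setT (EFin \o g o).
  exact: (integrable_dot dotE kappa_gt0 delta_gt0 sb).
have m_le o : ((m o)%:E <= \int[mu]_x (ramp c (g o x))%:E)%E.
  case: o => [j|] /=; last first.
    by apply: integral_ge0 => x _; rewrite lee_fin; have /andP[] := ramp01 c (g None x).
  have mS : measurable [set x : borel H | kappa * l (h j) <= `|dot x (h j)|].
    rewrite [X in measurable X](_ : _ = setT `&`
        (fun x : borel H => `|dot x (h j)|) @^-1` `[kappa * l (h j), +oo[%classic).
      have := measurableT_comp (@normr_measurable R setT) (measurable_dot dotE (h j)).
      by apply.
    by apply/seteqP; split=> x; rewrite /= in_itv/= andbT => // -[].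
  apply: (le_trans (small_ball_l2 kappa_gt0 delta_gt0 sb (h j))).
  rewrite -[X in mu X]setIT -integral_indic//.
  apply: ge0_le_integralT => x; rewrite lee_fin ?indicE//.
  case: (boolP (x \in _)) => [/set_mem /=|_]; last by have /andP[] := ramp01 c (g (Some j) x).
  rewrite [l2 _ _ _]lh => xh; rewrite ramp1//.
  by rewrite /c mulrAC -mulrA ler_pMr// ler_pdivlMr ?mul1r// mulr_gt0.
have rad : (\int[P]_w (maxover None (fun o => \sum_i eps i w * g o (X i w)))%:E <=
    (gamma * n%:R * r)%:E)%E.
  apply: le_trans r_rad; apply: ge0_le_integralT => w.
    rewrite lee_fin; apply: le_trans (maxover_ge _ _ None).
    by rewrite big1// => i _; rewrite /g linear0r mulr0.
  have [k ->] := maxover_eq None (fun o => \sum_i eps i w * g o (X i w)).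
  apply: ereal_sup_ubound; exists (h' k) => //; split.
    by case: k => [j|] /=; rewrite ?(is_norm00 N_norm).
  rewrite (L2norm_fin kappa_gt0 delta_gt0 sb) lee_fin -/l; case: k => [j|] /=.
    by rewrite lh.
  by rewrite /l (l20 dotE kappa_gt0 delta_gt0 sb) ltW.
pose p0 := expR (- (delta ^+ 2 * n%:R / 16)).
pose eta := Num.min p0 (n%:R * delta * (3 / 200)).
have eta0 : 0 < eta.
  by rewrite lt_min expR_gt0/= !mulr_gt0.
(* Any deviation [a] with [delta / sqrt 8 <= a < 3 / 8 * delta] would do: the lower
   bound gives the exponent [delta ^+ 2 * n / 16], the upper one leaves at least
   [n * delta / 2] of the ramp sum.  The factor 2 of [pfail] absorbs [eta]. *)
have a0 : 0 < 9 / 25 * delta by rewrite mulr_gt0.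
have g_None x : g None x = 0 by exact: linear0r.
have [B [mB PB HB]] := process_tail X_law eps_law XeI g_int
  g_None (ramp01 c) (fun x y => ramp_lip x y (ltW c0))
  (measurable_ramp c) m_le rad a0 eta0.
exists B; split=> //.
  apply: le_trans PB _; rewrite lee_fin /pfail -/p0 (_ : 2 * p0 = p0 + p0); last by lra.
  apply: lerD; last by rewrite /eta ge_min lexx.
  by rewrite ler_expR; have := mulr_gt0 n0 (exprn_gt0 2 delta_gt0); lra.
move=> w nBw j; have := HB w nBw (Some j).
rewrite /lower_isometry /= sumrB sumr_const card_ord -[delta *+ n]mulr_natl => HBj.
have eta_le : eta <= n%:R * delta * (3 / 200) by rewrite ge_min lexx orbT.
(* The value of [gamma] makes symmetrization cost 1/8 of [n * delta]. With the shares 9/25 of the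
   deviation and 3/200 of [eta], exactly one half is lost. *)
have LC : 2 * c * (gamma * n%:R * r) = n%:R * delta / 8.
  by rewrite /c gammaE; field; rewrite !gt_eqF.
have ramp_sum : n%:R * delta / 2 <= \sum_i ramp c (g (Some j) (X i w)).
  by move: HBj; rewrite LC; lra.
have : \sum_i ramp c (g (Some j) (X i w)) <= c ^+ 2 * \sum_i dot (X i w) (h j) ^+ 2.
  by rewrite mulr_sumr; apply: ler_sum => i _; exact: ramp_le_sqr.
move/(le_trans ramp_sum).
(* Dividing [n * delta / 2] by [c ^+ 2 = 4 / (kappa * r)^2] produces the constant
   [delta * kappa ^+ 2 / 8]. *)
rewrite -ler_pdivrMl ?exprn_gt0//; apply: le_trans; apply: le_of_eq.
by rewrite /c; field; rewrite !gt_eqF.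
Qed.

(** The bound [pfail] does not depend on the size of the finite family, so continuity from above
    along growing initial segments preserves it. *)
Lemma countable_lower_isometry (hseq : nat -> H) :
  (forall k, l (hseq k) = r) -> (forall k, N (hseq k) <= 1) ->
  exists E, [/\ measurable E, ((1 - pfail)%:E <= P E)%E &
    forall w, E w -> forall k, lower_isometry r w (hseq k)].
Proof.
move=> lh Nh.
pose G k := [set w | lower_isometry r w (hseq k)].
have mG k : measurable (G k).
  rewrite (_ : G k = setT `&` (fun w => \sum_i dot (X i w) (hseq k) ^+ 2) @^-1`
      `[n%:R * (delta * kappa ^+ 2 / 8) * r ^+ 2, +oo[%classic); last first.
    by apply/seteqP; split=> w; rewrite /= in_itv/= andbT => // -[].
  have : measurable_fun setT (fun w => \sum_i dot (X i w) (hseq k) ^+ 2).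
    apply: measurable_sum => i; apply: measurable_funX.
    by apply: (measurableT_comp (measurable_dot dotE (hseq k))); exact: measurable_funPT.
  by apply.
pose F m := \bigcap_(k in [set k | (k <= m)%N]) G k.
have mF m : measurable (F m) by exact: bigcap_measurableType.
have FE : \bigcap_m F m = \bigcap_k G k.
  apply/seteqP; split=> w Fw k _; last by move=> m _; exact: Fw.
  exact: (Fw k I k (leqnn k)).
exists (\bigcap_k G k); split=> [| |w Ew k]; last exact: (Ew k I).
  exact: bigcap_measurableType.
rewrite -FE.
have cvgF : (P \o F) m @[m --> \oo] --> P (\bigcap_m F m).
  apply: nonincreasing_cvg_mu => //.
  - by rewrite (le_lt_trans (probability_le1 _ _))// ltry.
  - exact: bigcap_measurableType.
  - by move=> m p mp; apply/subsetPset => w Fw k /= km; apply: Fw; exact: leq_trans km mp.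
apply: (cvg_lee cvgF) => m /=.
have [B [mB PB HB]] := finite_lower_isometry (h := fun j : 'I_m.+1 => hseq j)
  (fun j => lh j) (fun j => Nh j).
apply: (@le_trans _ _ (P (~` B))).
  by rewrite probability_setC// EFinB leeB.
apply: le_measure; rewrite ?inE//; first exact: measurableC.
move=> w nBw k /= km.
by have := HB w nBw (Ordinal (km : (k < m.+1)%N)).
Qed.

Lemma separable_lower_isometry (D : set H) : countable D -> D !=set0 ->
  exists E, [/\ measurable E, ((1 - pfail)%:E <= P E)%E &
    forall w, E w -> (forall i, closure D (X i w)) ->
    forall h, l h = r -> N h <= 1 -> lower_isometry r w h].
Proof.
move=> cD D0; pose K := [set h | l h = r /\ N h <= 1].
have [K0|nK0] := pselect (K !=set0); last first.
  exists setT; split=> // [|w _ _ h lh Nh]; last by case: nK0; exists h.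
  by rewrite probability_setT lee_fin lerBlDr lerDl mulr_ge0// expR_ge0.
have [hseq [Khseq approx]] := countable_weak_approx n dotE K0 cD D0.
have [E [mE PE HE]] := countable_lower_isometry
  (fun k => (Khseq k).1) (fun k => (Khseq k).2).
exists E; split=> // w Ew Dw h lh Nh; rewrite /lower_isometry.
apply/ler_addgt0Pr => e e0.
pose A := \sum_i `|dot (X i w) h|.
have A0 : 0 <= A by exact: sumr_ge0.
have Ai i : `|dot (X i w) h| <= A by rewrite /A (bigD1 i)//= lerDl sumr_ge0.
(* If every inner product moves by less than [t <= 1], then the sum of squares moves by at most
   [t * M]. *)
pose M := n%:R * (2 * A + 1).
have n0 : 0 < n%:R :> R by rewrite ltr0n.
have M0 : 0 < M by rewrite mulr_gt0// ltr_wpDl// mulr_ge0.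
pose t := Num.min 1 (e / M).
have t0 : 0 < t by rewrite lt_min ltr01 divr_gt0.
have t1 : t <= 1 by rewrite ge_min lexx.
have tM : t * M <= e by rewrite -ler_pdivlMr// ge_min lexx orbT.
have [k hk] := approx (fun i => X i w) Dw h t (conj lh Nh) t0.
apply: le_trans (HE w Ew k) _.
apply: (@le_trans _ _ (\sum_i (dot (X i w) h ^+ 2 + t * (2 * A + 1)))); last first.
  rewrite big_split sumr_const card_ord lerD2l -[_ *+ n]mulr_natl mulrCA.
  exact: tM.
apply: ler_sum => i _; have := hk i; have := Ai i.
move: (dot (X i w) h) (dot (X i w) (hseq k)) => a b aA abt.
have sqle : (b - a) ^+ 2 <= t.
  apply: (@le_trans _ _ (t * t)); last by rewrite ler_piMr// ltW.
  rewrite -real_normK ?num_real// distrC expr2.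
  by apply: ler_pM => //; exact: ltW.
have prodle : a * (b - a) <= A * t.
  apply: le_trans (ler_norm _) _; rewrite normrM (distrC b).
  by apply: ler_pM => //; exact: ltW.
lra.
Qed.

End FixedRadius.

Lemma lower_isometry_scale r w : 0 < r ->
  (forall h, l h = r -> N h <= 1 -> lower_isometry r w h) ->
  forall h, 0 < l h -> r * N h <= l h -> lower_isometry (l h) w h.
Proof.
move=> r0 Hr h lh0 rN.
have a0 : 0 < r / l h by rewrite divr_gt0.
have := Hr (r / l h *: h).
rewrite /l (l2Z dotE kappa_gt0 delta_gt0 sb) (is_normZ N_norm) gtr0_norm//.
rewrite -/l divfK ?gt_eqF// => /(_ erefl).
rewrite mulrAC ler_pdivrMr// mul1r => /(_ rN).
rewrite /lower_isometry; under eq_bigr do rewrite dotZr exprMn.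
rewrite -mulr_sumr => le1.
rewrite -(ler_pM2l (exprn_gt0 2 a0)); apply: le_trans le1.
by apply: le_of_eq; field; rewrite gt_eqF.
Qed.

Lemma rademacher_complexity_le r1 r2 : 0 < r1 -> r1 <= r2 ->
  (rademacher_complexity dot N mu X eps r1 <= rademacher_complexity dot N mu X eps r2)%E.
Proof.
move=> r10 r12; apply: ge0_le_integralT => w.
  apply: ereal_sup_ubound; exists 0; last by rewrite big1// => i _; rewrite linear0r mulr0.
  split; first by rewrite (is_norm00 N_norm).
  rewrite (L2norm_fin kappa_gt0 delta_gt0 sb) lee_fin.
  by rewrite (l20 dotE kappa_gt0 delta_gt0 sb) ltW.
apply: le_ereal_sup => _ [h [Nh lh] <-]; exists h => //; split=> //.
by apply: le_trans lh _; rewrite lee_fin.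
Qed.

Lemma rstar_ge0 : (0 <= rstar dot N mu X eps gamma)%E.
Proof. by apply: le_ereal_inf_tmp => _ [r [r0 _] <-]; rewrite lee_fin ltW. Qed.

Lemma rstar_approx rho e : rstar dot N mu X eps gamma = rho%:E -> 0 < e ->
  exists r, [/\ 0 < r, rho <= r, r < rho + e &
   (rademacher_complexity dot N mu X eps r <= (gamma * n%:R * r)%:E)%E].
Proof.
move=> rhoE e0.
have : (rstar dot N mu X eps gamma < (rho + e)%:E)%E by rewrite rhoE lte_fin ltrDl.
move/ereal_inf_lt => [_ [r [r0 Hr] <-]]; rewrite lte_fin => rlt.
exists r; split=> //; rewrite -lee_fin -rhoE.
by apply: ereal_inf_lbound; exists r.
Qed.

(** The complexity is nondecreasing in the radius and [gamma * n * r] is continuous in [r], so the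
    inequality passes from admissible radii decreasing to [rho] to [rho] itself. *)
Lemma rstar_attained rho : rstar dot N mu X eps gamma = rho%:E -> 0 < rho ->
  (rademacher_complexity dot N mu X eps rho <= (gamma * n%:R * rho)%:E)%E.
Proof.
move=> rhoE rho0; apply/lee_addgt0Pr => e e0.
have gn0 : 0 < gamma * n%:R by rewrite gammaE mulr_gt0 ?ltr0n// divr_gt0// mulr_gt0.
have [r [r0 rho_r r_lt Hr]] := rstar_approx rhoE (divr_gt0 e0 gn0).
apply: le_trans (rademacher_complexity_le rho0 rho_r) _; apply: le_trans Hr _.
rewrite -EFinD lee_fin -lerBlDl -mulrBr mulrC -ler_pdivlMr// lerBlDl.
exact: ltW.
Qed.

Lemma lower_isometry_event (D : set H) (rho : R) : countable D -> D !=set0 ->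
  rstar dot N mu X eps gamma = rho%:E ->
  exists E, [/\ measurable E, ((1 - pfail)%:E <= P E)%E &
    forall w, E w -> (forall i, closure D (X i w)) ->
    forall h, 0 < l h -> rho * N h <= l h -> lower_isometry (l h) w h].
Proof.
move=> cD D0 rhoE.
have rho_ge0 : 0 <= rho by rewrite -lee_fin -rhoE rstar_ge0.
have [rho0|rho_le0] := ltP 0 rho.
  have [E [mE PE HE]] :=
    separable_lower_isometry rho0 (rstar_attained rhoE rho0) cD D0.
  by exists E; split=> // w Ew Dw; apply: lower_isometry_scale rho0 _; exact: HE.
(* If [rho = 0], the infimum need not be attained: use admissible radii tending to 0
   and the limsup of the corresponding events. *)
have {rho_ge0 rho_le0} rho0 : rho = 0 by apply/eqP; rewrite eq_le rho_le0.
have /choice[rs rsP] k := rstar_approx rhoE (e := k.+1%:R^-1) ltac:(by rewrite invr_gt0).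
have /choice[Ev EvP] k : exists E, [/\ measurable E, ((1 - pfail)%:E <= P E)%E &
    forall w, E w -> (forall i, closure D (X i w)) ->
    forall h, l h = rs k -> N h <= 1 -> lower_isometry (rs k) w h].
  by have [rk0 _ _ Hr] := rsP k; exact: separable_lower_isometry.
have mE k : measurable (Ev k) by have [] := EvP k.
have mcup m : measurable (\bigcup_(k in [set k | (m <= k)%N]) Ev k).
  exact: bigcup_measurable.
exists (lim_sup_set Ev); split.
- exact: bigcap_measurableType.
- have cvgE := lim_sup_set_cvg P Ev mE.
  apply: cvg_lee (cvgE _) _ => [|m].
    by rewrite (le_lt_trans (probability_le1 _ _))// ltry.
  have [_ PE _] := EvP m; apply: le_trans PE _.
  apply: le_measure; rewrite ?inE// => w Ew; exists m => //=.
- move=> w Ew Dw h lh0 _.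
  have h0 : h <> 0.
    by move=> h0; move: lh0; rewrite h0 /l (l20 dotE kappa_gt0 delta_gt0 sb) ltxx.
  have Nh0 := is_norm_gt0 N_norm h0.
  (* For [k >= m] one has [rs k < 1 / (k + 1) < l h / N h], so [h] satisfies the cone condition at
     radius [rs k]. *)
  pose m := Num.bound (N h / l h).
  have [k /= mk Ek] := Ew m I.
  have [rk0 _ rk_lt _] := rsP k; have [_ _ HE] := EvP k.
  apply: (lower_isometry_scale rk0 (HE w Ek Dw) lh0).
  rewrite -ler_pdivlMr//; apply: ltW; apply: lt_trans rk_lt _.
  rewrite rho0 add0r -[ltRHS]invf_div ltf_pV2 ?posrE ?divr_gt0//.
  apply: (@lt_le_trans _ _ m%:R); last by rewrite ler_nat ltnW// ltnS.
  by apply: archi_boundP; rewrite divr_ge0 ?ltW.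
Qed.

End SmallBallMethod.

(** The sum of the squares [(c x_i - b y_i)^2] equals [c (a c - b^2)]; when [c = 0] every [y_i]
    vanishes. *)
Lemma sum_cauchy_schwarz (R : realType) (n : nat) (x y : 'I_n -> R) :
  (\sum_i x i * y i) ^+ 2 <= (\sum_i x i ^+ 2) * \sum_i y i ^+ 2.
Proof.
set a := \sum_i x i ^+ 2; set b := \sum_i x i * y i; set c := \sum_i y i ^+ 2.
have c0 : 0 <= c by apply: sumr_ge0 => i _; exact: sqr_ge0.
have : 0 <= \sum_i (c * x i - b * y i) ^+ 2.
  by apply: sumr_ge0 => i _; exact: sqr_ge0.
under eq_bigr => i _.
  rewrite (_ : _ ^+ 2 = c ^+ 2 * x i ^+ 2 - 2 * c * b * (x i * y i) +
    b ^+ 2 * y i ^+ 2); last by ring.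
  over.
rewrite big_split sumrB -!mulr_sumr -/a -/b -/c /=.
rewrite (_ : _ + _ = c * (a * c - b ^+ 2)); last by ring.
have [c_gt0|c_le0] := ltP 0 c; first by rewrite pmulr_rge0// subr_ge0.
have {c_le0} cE : c = 0 by apply/eqP; rewrite eq_le c_le0.
move=> _; rewrite (_ : b = 0) ?cE ?mulr0 ?expr0n//.
have /psumr_eq0P y0 : c = 0 by [].
apply: big1 => i _; have /eqP := y0 (fun i _ => sqr_ge0 _) i isT.
by rewrite sqrf_eq0 => /eqP ->; rewrite mulr0.
Qed.

(** * Deterministic inequalities for subgradients and minimizers *)

Section Deterministic.
Context {R : realType} {H : completeNormedModType R}.
Variables (dot : {dot H for idfun}) (N : H -> R).
Hypothesis N_norm : is_norm N.

(** The subgradient inequality: unit dual norm gives [dot g z <= N z] by normalizing [z], while [g]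
    attains the norm at [h0]. *)
Lemma subdiff_le h0 g y : subdiff dot N h0 g -> N h0 + dot g y <= N (h0 + y).
Proof.
move=> [g1 gh0]; rewrite -gh0 -linearDr; set z := _ + y.
have [->|/eqP z0] := eqVneq z 0; first by rewrite linear0r (is_norm00 N_norm).
have Nz := is_norm_gt0 N_norm z0.
have : ((dot g ((N z)^-1 *: z))%:E <= 1)%E.
  rewrite -g1; apply: ereal_sup_ubound; exists ((N z)^-1 *: z) => //=.
  by rewrite (is_normZ N_norm) gtr0_norm ?invr_gt0// mulVf// gt_eqF.
by rewrite lee_fin dotZr ler_pdivrMl// mulr1.
Qed.

(** The normalized [y] competes in the infimum defining [Delta]. The supremum over subgradients may
    not be attained, so one nearly optimal up to [e] is used. *)
Lemma Delta_growth mu (r : \bar R) h0 y zeta : y <> 0 ->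
  (zeta%:E <= Delta dot N mu r h0)%E ->
  (L2norm dot mu ((N y)^-1 *: y) <= r)%E ->
  N h0 + zeta * N y <= N (h0 + y).
Proof.
move=> y0 zD yr; have Ny := is_norm_gt0 N_norm y0.
apply/ler_addgt0Pr => e e0.
have : (zeta%:E <= ereal_sup
    [set (dot g ((N y)^-1 *: y))%:E | g in subdiff dot N h0])%E.
  apply: le_trans zD _; apply: ereal_inf_lbound.
  exists ((N y)^-1 *: y) => //; split=> //.
  by rewrite (is_normZ N_norm) gtr0_norm ?invr_gt0// mulVf// gt_eqF.
move=> zsup.
have : ((zeta - e / N y)%:E < ereal_sup
    [set (dot g ((N y)^-1 *: y))%:E | g in subdiff dot N h0])%E.
  by apply: lt_le_trans zsup; rewrite lte_fin ltrBlDr ltrDl divr_gt0.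
move=> /ereal_sup_gt[_ [g gh0 <-]]; rewrite lte_fin dotZr.
rewrite -(ltr_pM2l Ny) mulVKf ?gt_eqF// mulrBr (mulrC _ (e / _)) divfK ?gt_eqF//.
by have := subdiff_le y gh0; rewrite (mulrC _ zeta); lra.
Qed.

(** The vector [- (rho / l) *: y] competes in the supremum defining [Deltabar]; the minus sign turns
    a nearly minimal pairing into a lower bound on [dot g y]. *)
Lemma Deltabar_growth mu (rho l : R) h0 y zetabar : 0 < rho -> 0 < l ->
  (Deltabar dot N mu rho%:E h0 <= zetabar%:E)%E ->
  L2norm dot mu (- (rho / l) *: y) = rho%:E -> rho * N y <= l ->
  N h0 - zetabar * l / rho <= N (h0 + y).
Proof.
move=> rho0 l0 Dz yrho Ny; apply/ler_addgt0Pr => e e0.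
have c0 : 0 < rho / l by rewrite divr_gt0.
have : (ereal_inf [set (dot g (- (rho / l) *: y))%:E | g in subdiff dot N h0]
    < (zetabar + e * (rho / l))%:E)%E.
  apply: (@le_lt_trans _ _ zetabar%:E); last by rewrite lte_fin ltrDl mulr_gt0.
  apply: le_trans Dz; apply: ereal_sup_ubound; exists (- (rho / l) *: y) => //.
  split=> //; rewrite (is_normZ N_norm) normrN gtr0_norm//.
  by rewrite mulrAC ler_pdivrMr// mul1r.
move=> /ereal_inf_lt[_ [g gh0 <-]]; rewrite lte_fin dotZr mulNr ltrNl.
have -> : - (zetabar + e * (rho / l)) = rho / l * - (zetabar * l / rho + e).
  by field; rewrite !gt_eqF.
rewrite ltr_pM2l// => gy; have := subdiff_le y gh0; lra.
Qed.

Section Minimizers.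
Variables (n : nat) (x : 'I_n -> H) (xi : 'I_n -> R).
Variables (hstar hhat nuhat : H) (lambda : R).
Hypotheses (n_gt0 : (0 < n)%N) (lambda_gt0 : 0 < lambda).
Hypothesis hhat_min : is_minimizer setT
  (rerm_objective dot N lambda x (fun i => dot (x i) hstar + xi i)) hhat.
Hypothesis nuhat_min : is_minimizer (interpolants dot x xi) N nuhat.

Let D := hhat - hstar.
(** [s] and [t] are the empirical L2 norms of the noise and of the error. *)
Let s := euclidean_norm xi / Num.sqrt n%:R.
Let t := Num.sqrt (n%:R^-1 * \sum_i dot (x i) D ^+ 2).

Let n0 : 0 < n%:R :> R. Proof. by rewrite ltr0n. Qed.

Let sum_sqr_ge0 (y : 'I_n -> R) : 0 <= \sum_i y i ^+ 2.
Proof. by apply: sumr_ge0 => i _; exact: sqr_ge0. Qed.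

Let s_ge0 : 0 <= s. Proof. by rewrite divr_ge0 ?sqrtr_ge0. Qed.

Let t_ge0 : 0 <= t. Proof. exact: sqrtr_ge0. Qed.

Let s_sqr : s ^+ 2 = n%:R^-1 * \sum_i xi i ^+ 2.
Proof.
by rewrite /s /euclidean_norm expr_div_n !sqr_sqrtr// mulrC.
Qed.

Let t_sqr : t ^+ 2 = n%:R^-1 * \sum_i dot (x i) D ^+ 2.
Proof. by rewrite sqr_sqrtr// mulr_ge0// invr_ge0 ltW. Qed.

(** Comparison of the objective at [hhat] and [hstar], with the cross term bounded by the
    Cauchy-Schwarz inequality. *)
Lemma penalized_ineq : t ^+ 2 - 2 * s * t + 2 * lambda * (N hhat - N hstar) <= 0.
Proof.
have := hhat_min.2 hstar I; rewrite /rerm_objective.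
under eq_bigr => i _.
  rewrite (_ : _ ^+ 2 = xi i ^+ 2 - 2 * (xi i * dot (x i) D) + dot (x i) D ^+ 2).
    over.
  by rewrite /D linearBr /=; ring.
under [X in _ <= _ * X + _]eq_bigr do rewrite addrC addKr.
rewrite big_split sumrB -mulr_sumr /= !mulrDr mulrN -s_sqr -t_sqr.
have : n%:R^-1 * \sum_i xi i * dot (x i) D <= s * t.
  apply: le_trans (ler_norm _) _.
  have st0 := mulr_ge0 s_ge0 t_ge0.
  rewrite -ler_sqr ?nnegrE// real_normK ?num_real//.
  rewrite [leRHS]exprMn s_sqr t_sqr [leLHS]exprMn [leRHS]mulrACA -(expr2 n%:R^-1).
  rewrite ler_wpM2l ?sqr_ge0//.
  exact: sum_cauchy_schwarz.
rewrite [n%:R^-1 * (2 * _)]mulrCA; move: (n%:R^-1 * \sum_i _) => c; lra.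
Qed.

(** The competitor [hstar + nuhat] has zero empirical loss, so only the penalties remain to be
    compared. *)
Lemma norm_hhat_le : N hhat <= N hstar + N nuhat.
Proof.
apply: le_trans (is_normD N_norm _ _).
rewrite -(ler_pM2l (mulr_gt0 (ltr0Sn R 1) lambda_gt0)).
have := hhat_min.2 (hstar + nuhat) I; rewrite /rerm_objective.
rewrite [X in _ <= _ * X + _ -> _]big1 ?mulr0 ?add0r => [|i _].
  by apply: le_trans; rewrite lerDr mulr_ge0// invr_ge0 ltW.
by rewrite linearDr /= (nuhat_min.1 i) subrr expr0n.
Qed.

Lemma norm_error_le : N D <= 2 * N hstar + N nuhat.
Proof.
apply: le_trans (is_normD N_norm _ _) _; rewrite (is_normN N_norm).
have := norm_hhat_le; lra.
Qed.

Lemma trivial_error : N hstar = 0 -> N nuhat = 0 -> D = 0.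
Proof.
move=> h0 nu0; apply: (is_norm0 N_norm); apply/eqP.
have := norm_error_le; rewrite h0 nu0 mulr0 addr0 => N_le0.
by rewrite eq_le N_le0 (is_norm_ge0 N_norm).
Qed.

Variables (kappa delta l : R).
Hypotheses (kappa_gt0 : 0 < kappa) (delta_gt0 : 0 < delta) (l_ge0 : 0 <= l).
Hypothesis iso :
  n%:R * (delta * kappa ^+ 2 / 8) * l ^+ 2 <= \sum_i dot (x i) D ^+ 2.

(** The inverse square root of [delta * kappa ^+ 2 / 8], which converts [t] into a bound on [l]. *)
Let C := Num.sqrt 8 / (Num.sqrt delta * kappa).

Let C_gt0 : 0 < C.
Proof. by rewrite divr_gt0 ?mulr_gt0 ?sqrtr_gt0. Qed.

Let C_sqr : C ^+ 2 = 8 / (delta * kappa ^+ 2).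
Proof. by rewrite expr_div_n exprMn !sqr_sqrtr// ltW. Qed.

Let l_le : l <= C * t.
Proof.
have Ct0 := mulr_ge0 (ltW C_gt0) t_ge0.
rewrite -ler_sqr ?nnegrE//.
have c0 : 0 < delta * kappa ^+ 2 / 8 by rewrite divr_gt0 ?mulr_gt0 ?exprn_gt0.
by rewrite exprMn C_sqr t_sqr -invf_div ler_pdivlMl// ler_pdivlMl// mulrA.
Qed.

Lemma error_le_noise_bias : l <=
  2 * Num.sqrt 8 / (Num.sqrt delta * kappa) * (s + Num.sqrt (lambda * N hstar)).
Proof.
have Nh : 0 <= lambda * N hstar by apply: mulr_ge0; [exact: ltW | exact: is_norm_ge0].
set q := Num.sqrt (lambda * N hstar); have q0 : 0 <= q := sqrtr_ge0 _.
have q2 : q ^+ 2 = lambda * N hstar := sqr_sqrtr Nh.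
(* Dropping the penalty of [hhat] leaves [t^2 - 2 s t - 2 q^2 <= 0], which fails for
   [t > 2 (s + q)]. *)
have t_le : t <= 2 * (s + q).
  rewrite leNgt; apply/negP => t_gt.
  have := penalized_ineq.
  have := mulr_ge0 (ltW lambda_gt0) (is_norm_ge0 N_norm hhat).
  have -> : 2 * lambda * (N hhat - N hstar) = 2 * (lambda * N hhat) - 2 * q ^+ 2.
    by rewrite q2; ring.
  have t_gt0 : 0 < t by apply: le_lt_trans t_gt; rewrite mulr_ge0// addr_ge0.
  have gap : 0 < t - 2 * (s + q) by rewrite subr_gt0.
  have := mulr_gt0 t_gt0 gap; have := mulr_ge0 q0 (ltW gap); have := mulr_ge0 q0 s_ge0.
  have := sqr_ge0 q; move: (lambda * N hhat) => z; lra.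
apply: le_trans l_le _; rewrite -(mulrA 2) -/C (mulrC 2) -(mulrA C).
by apply: ler_wpM2l => //; exact: ltW.
Qed.

(** The loss of penalty is at most [b * l <= b * C * t], linear in [t], so the quadratic inequality
    can be divided by [t]. *)
Lemma error_le_noise_subdiff (b : R) : N hstar - b * l <= N hhat -> 0 <= b ->
  l <= 4 * Num.sqrt 8 / (Num.sqrt delta * kappa) * s +
       32 / (delta * kappa ^+ 2) * (lambda * b).
Proof.
move=> Nhhat b0.
have lb0 : 0 <= lambda * b by rewrite mulr_ge0// ltW.
have t_le : t <= 2 * s + 2 * lambda * b * C.
  have [t_gt0|t_le0] := ltP 0 t; last first.
    apply: le_trans t_le0 _.
    by have := mulr_ge0 lb0 (ltW C_gt0); have := s_ge0; lra.
  rewrite -(ler_pM2l t_gt0).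
  have : lambda * b * l <= lambda * b * (C * t) by rewrite ler_wpM2l.
  have : lambda * (N hstar - N hhat) <= lambda * (b * l) by rewrite ler_pM2l//; lra.
  have := penalized_ineq; rewrite -expr2.
  rewrite !mulrBr !mulrA; lra.
apply: le_trans l_le _.
apply: (@le_trans _ _ (C * (2 * s + 2 * lambda * b * C))); first by rewrite ler_pM2l.
have -> : C * (2 * s + 2 * lambda * b * C) = 2 * (C * s) + 2 * (lambda * b) * C ^+ 2.
  by ring.
(* Since [C ^+ 2 = 8 / (delta * kappa ^+ 2)], the stated constants 4 and 32 are twice those just
   obtained. *)
have -> : 4 * Num.sqrt 8 / (Num.sqrt delta * kappa) * s +
    32 / (delta * kappa ^+ 2) * (lambda * b) = 4 * (C * s) + 4 * (lambda * b) * C ^+ 2.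
  by rewrite C_sqr /C; field; rewrite !gt_eqF ?sqrtr_gt0.
have Cs : 0 <= C * s := mulr_ge0 (ltW C_gt0) s_ge0.
have lb : 0 <= lambda * b * C ^+ 2 := mulr_ge0 lb0 (sqr_ge0 C).
lra.
Qed.

End Minimizers.
End Deterministic.

(** * Construction of the event and derivation of the two bounds *)

Theorem theorem2p2 (R : realType) (H : completeNormedModType R)
  (dot : {dot H for idfun}) (N : H -> R)
  (mu : probability (borel H) R)
  (d : measure_display) (Omega : measurableType d) (P : probability Omega R)
  (n : nat) (X : 'I_n -> {RV P >-> borel H}) (eps : 'I_n -> {RV P >-> R})
  (xi Y : Omega -> 'I_n -> R) (hstar : H)
  (kappa delta gamma lambda : R) (hhat nuhat : Omega -> H)
  (dotE : hilbertian dot)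
  (N_norm : is_norm N)
  (n_gt0 : (0 < n)%N)
  (mu_sep : separably_supported mu)
  (X_law : forall i A, measurable A -> distribution P (X i) A = mu A)
  (eps_law : forall i, is_rademacher P (eps i))
  (X_eps_indep : mutually_independent P (fun k : 'I_n + 'I_n =>
     match k with inl i => sigma_of (X i) | inr i => sigma_of (eps i) end))
  (Y_model : forall w i, Y w i = dot (X i w) hstar + xi w i)
  (kappa_gt0 : 0 < kappa) (delta_gt0 : 0 < delta)
  (mu_small_ball : small_ball dot mu kappa delta)
  (gammaE : gamma = kappa * delta / 32)
  (lambda_gt0 : 0 < lambda)
  (hhat_min : {ae P, forall w,
     is_minimizer setT (rerm_objective dot N lambda (fun i => X i w) (Y w))
       (hhat w)})
  (nuhat_min : {ae P, forall w,
     is_minimizer (interpolants dot (fun i => X i w) (xi w)) N (nuhat w)}) :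
  let r := rstar dot N mu X eps gamma in
  exists E : set Omega,
    [/\ measurable E,
        ((1 - 2 * expR (- (delta ^+ 2 * n%:R / 16)))%:E <= P E)%E &
        forall w, E w ->
          (L2norm dot mu (hhat w - hstar)%R <=
             maxe (2 * Num.sqrt 8 / (Num.sqrt delta * kappa) *
                     (euclidean_norm (xi w) / Num.sqrt n%:R +
                      Num.sqrt (lambda * N hstar)))%:E
                  (r * (2 * N hstar + N (nuhat w))%:E))%E
          /\
          forall zeta zetabar : R, 0 < zeta -> 0 < zetabar ->
            (zeta%:E <= Delta dot N mu r hstar)%E ->
            (Deltabar dot N mu r hstar <= zetabar%:E)%E ->
            (L2norm dot mu (hhat w - hstar)%R <=
               maxe ((4 * Num.sqrt 8 / (Num.sqrt delta * kappa) *
                        (euclidean_norm (xi w) / Num.sqrt n%:R))%:E +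
                     (32 / (delta * kappa ^+ 2))%:E *
                       ((lambda * zetabar)%:E / r))
                    (r * (N (nuhat w))%:E / zeta%:E))%E].
Proof.
move=> r.
pose p := 2 * expR (- (delta ^+ 2 * n%:R / 16)).
have [D cD muD] := mu_sep.
have mD : measurable (closure D : set (borel H)).
  have cD' : open (~` closure D) by exact/closed_openC/closed_closure.
  by rewrite -[closure D]setCK; apply: measurableC; exact: sub_sigma_algebra.
have D0 : D !=set0.
  apply/set0P/eqP => D0; move: muD; rewrite D0 closure0 measure0 => /eqP.
  by rewrite eq_sym onee_eq0.
have sepX i : {ae P, forall w, closure D (X i w)}.
  have mXD : measurable (X i @^-1` closure D).
    by rewrite -[X in measurable X]setTI; exact: (measurable_funPT (X i)).
  exists (~` (X i @^-1` closure D)); split=> //; first exact: measurableC.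
  have PXD : P (X i @^-1` closure D) = 1%E by rewrite (prob_X X_law).
  by rewrite probability_setC// PXD subee.
have {}sepX : {ae P, forall w, forall i, closure D (X i w)}.
  by apply: filter_forall.
(* A single null set carries all the almost sure exceptions; it is removed from the event. *)
have [Z [mZ PZ ZQ]] := filterI sepX (filterI hhat_min nuhat_min).
have L2E := L2norm_fin kappa_gt0 delta_gt0 mu_small_ball.
have [E1 [mE1 PE1 HE1]] : exists E1, [/\ measurable E1, ((1 - p)%:E <= P E1)%E &
    forall w, E1 w -> (forall i, closure D (X i w)) ->
    forall rho, r = rho%:E -> forall h, 0 < l2 dot mu h ->
    rho * N h <= l2 dot mu h ->
    lower_isometry dot X kappa delta (l2 dot mu h) w h].
  have [rfin|/fin_numPn rinf] := boolP (r \is a fin_num).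
    have [E1 [mE1 PE1 HE1]] := lower_isometry_event dotE N_norm n_gt0 X_law
      eps_law X_eps_indep kappa_gt0 delta_gt0 mu_small_ball gammaE cD D0
      (esym (fineK rfin)).
    exists E1; split=> // w Ew Dw rho rhoE h lh Nh.
    by apply: HE1 => //; rewrite rhoE.
  (* For infinite [r] the requirement is vacuous and the whole space serves. *)
  exists setT; split=> // [|w _ _ rho rhoE].
    by rewrite probability_setT lee_fin lerBlDr lerDl mulr_ge0// expR_ge0.
  by move: rinf; rewrite rhoE => -[].
exists (E1 `\` Z); split; first exact: measurableD.
  apply: le_trans PE1 _; rewrite (measureDI P mE1 mZ) -[leRHS]adde0; apply: leeD2l.
  by rewrite -PZ; apply: le_measure; rewrite ?inE//; exact: measurableI.
move=> w [E1w nZw].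
have /= [Dw [hmin numin]] : (forall i, closure D (X i w)) /\
    (is_minimizer setT (rerm_objective dot N lambda (fun i => X i w) (Y w)) (hhat w) /\
     is_minimizer (interpolants dot (fun i => X i w) (xi w)) N (nuhat w)).
  by apply: contrapT => /ZQ.
have {}hmin : is_minimizer setT (rerm_objective dot N lambda (fun i => X i w)
    (fun i => dot (X i w) hstar + xi w i)) (hhat w).
  by rewrite -(funext (Y_model w)).
have HE := HE1 w E1w Dw.
pose y := hhat w - hstar; rewrite -/y L2E.
have hstar_y : hstar + y = hhat w by rewrite addrC subrK.
have Nnu0 := is_norm_ge0 N_norm (nuhat w).
have Nh0 := is_norm_ge0 N_norm hstar.
have ly0 : 0 <= l2 dot mu y by exact: l2_ge0.
have l0 : l2 dot mu 0 = 0 by exact: l20 dotE kappa_gt0 delta_gt0 mu_small_ball.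
have Nhhat := norm_hhat_le N_norm lambda_gt0 hmin numin.
have Ny := norm_error_le N_norm lambda_gt0 hmin numin.
have y_triv : N hstar = 0 -> N (nuhat w) = 0 -> y = 0 :=
  trivial_error N_norm lambda_gt0 hmin numin.
have s0 : 0 <= euclidean_norm (xi w) / Num.sqrt n%:R by rewrite divr_ge0 ?sqrtr_ge0.
have C0 : 0 <= (Num.sqrt delta * kappa)^-1.
  by rewrite invr_ge0 mulr_ge0 ?sqrtr_ge0// ltW.
have r_ge0 : (0 <= r)%E by exact: rstar_ge0.
clear HE1; case: r r_ge0 HE => [rho| |//].
  move=> rho_ge0' HE; have rho0 : 0 <= rho by rewrite -lee_fin.
  have iso := HE rho erefl y.
  split.
    rewrite le_max -EFinM !lee_fin; apply/orP.
    have [ly_gt0|ly_le0] := ltP 0 (l2 dot mu y); last first.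
      left; apply: le_trans ly_le0 _.
      by rewrite !mulr_ge0 ?addr_ge0 ?sqrtr_ge0.
    have [rhoN|rhoN] := leP (rho * N y) (l2 dot mu y).
      left; apply: (error_le_noise_bias N_norm n_gt0 lambda_gt0 hmin) => //.
      exact: iso.
    by right; apply: le_trans (ltW rhoN) _; rewrite ler_wpM2l.
  move=> zeta zetabar zeta0 zetabar0 zD Dz.
  (* At [rho = 0] the term [lambda * zetabar / rho] is +oo and the bound is trivial. *)
  have [rho_gt0|rho_le0] := ltP 0 rho; last first.
    have -> : rho = 0 by apply/eqP; rewrite eq_le rho_le0.
    rewrite le_max inve0 gt0_muley ?lte_fin ?mulr_gt0// gt0_muley; last first.
      by rewrite lte_fin divr_gt0// mulr_gt0// exprn_gt0.
    by rewrite addey ?leey.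
  rewrite !inver !gt_eqF// -!EFinM -EFinD le_max !lee_fin; apply/orP.
  have [ly_gt0|ly_le0] := ltP 0 (l2 dot mu y); last first.
    left; apply: le_trans ly_le0 _; apply: addr_ge0.
      by rewrite !mulr_ge0 ?sqrtr_ge0.
    by rewrite ltW// !mulr_gt0 ?invr_gt0 ?mulr_gt0 ?exprn_gt0.
  have y0 : y <> 0 by move=> y0; rewrite y0 l0 ltxx in ly_gt0.
  have Ny_gt0 := is_norm_gt0 N_norm y0.
  have [rhoN|rhoN] := leP (rho * N y) (l2 dot mu y).
    left; rewrite -(mulrA lambda).
    apply: (error_le_noise_subdiff n_gt0 lambda_gt0 hmin) => //.
    - exact: iso.
    - rewrite -hstar_y mulrAC.
      apply: (Deltabar_growth N_norm rho_gt0 ly_gt0 Dz) => //.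
      rewrite L2E (l2Z dotE kappa_gt0 delta_gt0 mu_small_ball) normrN.
      by rewrite gtr0_norm ?divr_gt0// divfK// gt_eqF.
    - by rewrite divr_ge0// ltW.
  right; apply: le_trans (ltW rhoN) _; rewrite -mulrA ler_wpM2l//.
  rewrite ler_pdivlMr// mulrC.
  (* The normalized error has L2 norm below [rho], so [Delta] applies; combined with
     [N hhat <= N hstar + N nuhat] it gives [zeta * N y <= N nuhat]. *)
  have : N hstar + zeta * N y <= N (hstar + y).
    apply: (Delta_growth N_norm y0 zD).
    rewrite L2E lee_fin (l2Z dotE kappa_gt0 delta_gt0 mu_small_ball).
    by rewrite gtr0_norm ?invr_gt0// ler_pdivrMl// mulrC ltW.
  by rewrite hstar_y; lra.
(* Now [r] is +oo. The second term of each maximum is +oo unless its other factor vanishes; as 0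
   times +oo is 0, these degenerate cases need a direct argument. *)
move=> _ _.
have [nu0|nu_neq0] := eqVneq (N (nuhat w)) 0; last first.
  have nu_gt0 : 0 < N (nuhat w) by rewrite lt_neqAle eq_sym nu_neq0.
  split=> [|zeta zetabar zeta0 zetabar0 _ _].
    by rewrite gt0_mulye ?lte_fin ?le_max ?leey ?orbT// ltr_wpDl// mulr_ge0.
  by rewrite inver gt_eqF// gt0_mulye ?lte_fin// gt0_mulye ?lte_fin ?invr_gt0//
    le_max leey orbT.
split=> [|zeta zetabar zeta0 zetabar0 zD _].
  have [h0|h_neq0] := eqVneq (N hstar) 0; last first.
    have h_gt0 : 0 < N hstar by rewrite lt_neqAle eq_sym h_neq0.
    by rewrite gt0_mulye ?lte_fin ?le_max ?leey ?orbT// ltr_wpDr// mulr_gt0.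
  rewrite y_triv// l0 le_max lee_fin !mulr_ge0 ?addr_ge0 ?sqrtr_ge0//.
have [h0|h_neq0] := eqVneq hstar 0.
  rewrite y_triv ?h0 ?(is_norm00 N_norm)// l0 invey mule0 mule0 adde0.
  by rewrite le_max lee_fin !mulr_ge0 ?sqrtr_ge0.
have h_gt0 := is_norm_gt0 N_norm (elimN eqP h_neq0).
(* Testing [Delta] at the direction of [- hstar] would give [(1 + zeta) * N hstar <= N 0 = 0], so
   this case is contradictory. *)
have hN0 : - hstar <> 0 by apply/eqP; rewrite oppr_eq0.
have := Delta_growth N_norm hN0 zD (leey _).
rewrite subrr (is_norm00 N_norm) (is_normN N_norm).
by rewrite leNgt addr_gt0// mulr_gt0.
Qed.
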